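(* There exists an absolute constant $c>0$ such that the following holds. Let $h>0$, $a\geqslant0$, and integers $N\geqslant0$, $P\geqslant1$. Let $X$, $X_{n,k}$ be i.i.d. standard Logistic random variables, $P_n\sim\mathsf{Poisson}(\tfrac12a^22^n)$ ($n=0,\ldots,N$), and $Z_n\sim\mathsf N(0,1)$ ($n=0,\ldots,N$), all mutually independent. Define \[ A_N(h)=\frac{h}{2\pi}\Bigl(X+\sum_{n=0}^N\frac{1}{2^n}\sum_{k=1}^{P_n}X_{n,k}\Bigr), \] \[ Y_N(h)=\frac{h}{2\pi}\Biggl(X+\sum_{n=0}^N\frac{1}{2^n}\Bigl(\mathbf 1_{\{P_n<P\}}\sum_{k=1}^{P_n}X_{n,k}+\mathbf 1_{\{P_n\geqslant P\}}\sqrt{P_n/3}\,\pi\,Z_n\Bigr)\Biggr), \] and let $F_A$ and $F_Y$ be the distribution functions of $A_N(h)$ and $Y_N(h)$. Then for all $x\in\mathbb R$, \[ \bigl|F_A(x)-F_Y(x)\bigr|\leqslant c\,\frac{N+1}{\sqrt P}. \]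
   Context: A standard Logistic random variable has density $e^{-x}/(1+e^{-x})^2$ on $\mathbb R$, mean $0$ and variance $\pi^2/3$. Empty sums are $0$. The constant $c$ does not depend on $h,a,N,P,x$. *)

(* Defs.v *)
From HB Require Import structures.
From mathcomp Require Import all_boot all_order all_algebra.
From mathcomp Require Import all_classical all_reals all_analysis.
Set Implicit Arguments. Unset Strict Implicit. Unset Printing Implicit Defensive.
Import Order.TTheory GRing.Theory Num.Theory.
Import numFieldNormedType.Exports.
Local Open Scope classical_set_scope.
Local Open Scope ring_scope.

Definition logistic_pdf {R : realType} (x : R) : R :=
  expR (- x) / (1 + expR (- x)) ^+ 2.

(* Poisson(rate) probability of the value k (rate >= 0; 0^0 = 1). *)
Definition poisson_mass {R : realType} (rate : R) (k : nat) : R :=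
  rate ^+ k / k`!%:R * expR (- rate).

Definition mutually_independent {d} {T : measurableType d} {R : realType}
  (Pr : probability T R) {I : eqType} (D : set I) (V : I -> T -> R) : Prop :=
  forall (J : seq I), uniq J -> [set` J] `<=` D ->
  forall B : I -> set R, (forall i, measurable (B i)) ->
  Pr (\bigcap_(i in [set` J]) (V i @^-1` B i)) =
  (\prod_(i <- J) Pr (V i @^-1` B i))%E.

(* Index set of the random variables of the theorem:
   inl (inl tt)      : X
   inl (inr (n, k))  : X_{n,k}
   inr (inl n)       : P_n   (viewed as a real random variable)
   inr (inr n)       : Z_n *)
Definition idx := ((unit + (nat * nat)) + (nat + nat))%type.

Definition valid_idx (N : nat) (i : idx) : Prop :=
  match i with
  | inl (inl _) => True
  | inl (inr (n, k)) => (n <= N)%N /\ (1 <= k)%N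
  | inr (inl n) => (n <= N)%N
  | inr (inr n) => (n <= N)%N
  end.

Definition rv_family {T : Type} {R : realType} (X : T -> R)
  (Xnk : nat -> nat -> T -> R) (Pn : nat -> T -> nat) (Z : nat -> T -> R)
  (i : idx) : T -> R :=
  match i with
  | inl (inl _) => X
  | inl (inr (n, k)) => Xnk n k
  | inr (inl n) => fun t => (Pn n t)%:R
  | inr (inr n) => Z n
  end.

Definition A_N {T : Type} {R : realType} (h : R) (N : nat) (X : T -> R)
  (Xnk : nat -> nat -> T -> R) (Pn : nat -> T -> nat) (t : T) : R :=
  h / (2 * pi) * (X t + \sum_(0 <= n < N.+1)
     (2 ^+ n)^-1 * \sum_(1 <= k < (Pn n t).+1) Xnk n k t).

Definition Y_N {T : Type} {R : realType} (h : R) (N P : nat) (X : T -> R)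
  (Xnk : nat -> nat -> T -> R) (Pn : nat -> T -> nat) (Z : nat -> T -> R)
  (t : T) : R :=
  h / (2 * pi) * (X t + \sum_(0 <= n < N.+1)
     (2 ^+ n)^-1 *
       (if (Pn n t < P)%N then \sum_(1 <= k < (Pn n t).+1) Xnk n k t
        else Num.sqrt ((Pn n t)%:R / 3) * pi * Z n t)).

(* Main.v *)
Require Import Defs.
From HB Require Import structures.
From mathcomp Require Import all_boot all_order all_algebra.
From mathcomp Require Import all_classical all_reals all_analysis.
From mathcomp Require Import measurable_realfun ring lra zify.
Import Order.TTheory GRing.Theory Num.Theory.
Import numFieldNormedType.Exports.
Local Open Scope classical_set_scope.
Local Open Scope ring_scope.
Set Implicit Arguments. Unset Strict Implicit. Unset Printing Implicit Defensive.

(* Write L for the averaging operator of the logistic law, T_r for that of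
   N(0, r^2), and sigma^2 = pi^2/3 for the logistic variance. The key estimate is
   |L^p g - T_(sigma sqrt p) g| <= C / p for every measurable g with values in
   [0, 1]. Telescoping reduces it to bounding (L - T_sigma) L^j T_(sqrt s). For
   j = 0, both laws are symmetric with the same variance, so a fourth-order
   Taylor expansion of the Gaussian kernel gives O(1 / (s + 1)^2). For j > 0, the
   logistic density is at least 1/8 of the standard Gaussian density, so
   L = T_1 / 8 + (7/8) M with M a contraction commuting with everything; since
   T_1 T_(sqrt s) = T_(sqrt (s + 1)), induction on j shows that each factor L
   regularises like a Gaussian of variance 1/32.
   The blocks n = 0, ..., N are then exchanged one at a time: given P_n = p >= P,
   the rest of the sum is independent of block n, and the estimate applies to its
   distribution function. *)

(** * Integration against densities and affine changes of variable *)

Section integral_tools.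
Local Open Scope ereal_scope.
Import HBNNSimple.

(** The test function is the distribution function of everything outside one block, so it may have
    no regularity: all smoothness must come from the convolution kernels. In the telescoping sum for
    p variables the Gaussian part has variance of order p - j, which smooths well only while j stays
    away from p; for j near p the j logistic factors have to do the smoothing, and that is what the
    Gaussian minorant of the logistic density provides. Each of the p terms is then O(1 / p^2). The
    two variances must agree exactly. A mismatch would leave a second-order term of size about 1 / p
    at every step, and p such terms do not add up to anything small. Hence the logistic variance is
    computed in closed form, which is where the Basel sum enters. *)

Lemma ge0_integral_density {R : realType} d (T : measurableType d)
    (m mu : {measure set T -> \bar R}) (f : T -> R) (g : T -> \bar R) :
  measurable_fun setT f -> (forall x, 0 <= f x)%R ->
  (forall B, measurable B -> m B = \int[mu]_(x in B) (f x)%:E) ->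
  measurable_fun setT g -> (forall x, 0 <= g x) ->
  \int[m]_x g x = \int[mu]_x (g x * (f x)%:E).
Proof.
move=> mf f0 mE mg g0.
pose g_ := nnsfun_approx measurableT mg.
have g_E x : g x = limn (fun n => (g_ n x)%:E).
  by apply/esym/cvg_lim => //; apply: cvg_nnsfun_approx => // y _; exact: g0.
transitivity (limn (fun n => \int[m]_x (g_ n x)%:E)).
  rewrite -monotone_convergence//.
  - by apply: eq_integral => y _; exact: g_E.
  - by move=> n; exact/measurable_EFinP/measurable_funP.
  - by move=> n y _; rewrite lee_fin.
  - by move=> y _ i j ij; rewrite lee_fin; exact/lefP/nd_nnsfun_approx.
transitivity (limn (fun n => \int[mu]_x ((g_ n x)%:E * (f x)%:E))); last first.
  rewrite -monotone_convergence//.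
  - apply: eq_integral => y _; apply/cvg_lim => //.
    apply: cvgeZr => //; apply: cvg_nnsfun_approx => // z _; exact: g0.
  - by move=> n; apply/measurable_EFinP; exact: measurable_funM.
  - by move=> n y _; rewrite -EFinM lee_fin mulr_ge0.
  - move=> y _ i j ij; rewrite -!EFinM lee_fin ler_wpM2r//.
    exact/lefP/nd_nnsfun_approx.
congr (limn _); apply/funext => n.
have mA r : measurable (g_ n @^-1` [set r]) by [].
transitivity (\sum_(k \in range (g_ n))
    \int[m]_x (k * \1_(g_ n @^-1` [set k]) x)%:E).
  under eq_integral do rewrite fimfunE -fsumEFin//.
  rewrite ge0_integral_fsum//.
  - by move=> y; exact/measurable_EFinP/measurable_funM.
  - by move=> y x _; rewrite ?EFinM nnfun_muleindic_ge0.
transitivity (\sum_(k \in range (g_ n))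
    \int[mu]_x ((k * \1_(g_ n @^-1` [set k]) x)%:E * (f x)%:E)); last first.
  rewrite -ge0_integral_fsum//.
  - apply: eq_integral => x _; rewrite [in RHS]fimfunE -fsumEFin// ge0_mule_fsuml//.
    by move=> k; rewrite ?EFinM nnfun_muleindic_ge0.
  - by move=> k; apply/measurable_EFinP/measurable_funM => //; exact: measurable_funM.
  - move=> k x _; apply: mule_ge0; last by rewrite lee_fin.
    by rewrite EFinM nnfun_muleindic_ge0.
apply: eq_fsbigr => r /[!inE] -[x0 _ <-].
rewrite integralZl_indic_nnsfun// integral_indic// setIT.
under [RHS]eq_integral do rewrite EFinM -muleA.
rewrite ge0_integralZl//.
- rewrite mE// integral_mkcond; congr (_ * _); apply: eq_integral => x _.
  rewrite patchE indicE; case: ifPn => _; by rewrite ?mul1e ?mul0e.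
- by apply/measurable_EFinP; apply: measurable_funM.
- by move=> x _; rewrite mule_ge0 ?lee_fin.
- by rewrite lee_fin.
Qed.

(** The pushforward of Lebesgue measure under [a * x + b], multiplied by [a], gives each interval
    ]c, d] its length, and Lebesgue measure is the only measure that does so. *)
Lemma ge0_integral_affine {R : realType} (a b : R) (g : R -> \bar R) :
  (0 < a)%R -> measurable_fun setT g -> (forall x, 0 <= g x) ->
  \int[lebesgue_measure]_x g (a * x + b)%R * a%:E = \int[lebesgue_measure]_x g x.
Proof.
move=> a0 mg g0.
pose h (x : measurableTypeR R) : measurableTypeR R := (a * x + b)%R.
have mh : measurable_fun setT h.
  by apply: measurable_funD => //; exact: measurable_funM.
pose q : {measure set (measurableTypeR R) -> \bar R} :=
  pushforward (@lebesgue_measure R) h.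
pose p := q mh.
have a0' : (0 <= a)%R by exact: ltW.
pose m : {measure set (measurableTypeR R) -> \bar R} := mscale (NngNum a0') p.
have E A : measurable A -> @lebesgue_measure R A = m A.
  apply: lebesgue_measure_unique => _ [[c d]] _ <-.
  rewrite /m /mscale/= /p /q /pushforward/=.
  rewrite [X in _ = _ * lebesgue_measure X](_ : _ =
      `]((c - b) / a)%R, ((d - b) / a)%R]%classic); last first.
    by apply/seteqP; split => x /=; rewrite !in_itv/= /h;
      rewrite ltr_pdivrMr// ler_pdivlMr// [(x * a)%R]mulrC ltrBlDr lerBrDr.
  rewrite !lebesgue_measure_itv/= !lte_fin ltr_pM2r ?invr_gt0// ltrD2r.
  case: ifPn => _; last by rewrite mule0.
  by rewrite -!EFinB -EFinM; congr EFin; field; rewrite gt_eqF.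
transitivity (\int[m]_x g x); last first.
  by apply: eq_measure_integral => A mA _; exact/esym/E.
rewrite ge0_integral_mscale//= muleC; congr (_ * _).
by rewrite ge0_integral_pushforward.
Qed.

End integral_tools.

(** * Averaging operators *)

(** Nonnegativity gives access to Tonelli's theorem without integrability conditions. The bound [B]
    is a parameter because the induction in [swap_iter] passes from [B] to [7 / 8 * B]. *)
Definition nnbounded {R : realType} d (T : measurableType d) (B : R) (g : T -> R) :=
  measurable_fun setT g /\ forall x, 0 <= g x <= B.

(** The expectation of g(x - r Y) for Y of law [m]. If [g] is the distribution function of U
    independent of Y, this is the distribution function of U + r Y. *)
Definition avg {R : realType} (m : probability (measurableTypeR R) R) (r : R)
  (g : R -> R) (x : R) : R := \int[m]_y g (x - r * y).

Section avg.
Context {R : realType}.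
Implicit Types (m : probability (measurableTypeR R) R) (r B : R) (g : R -> R).

Lemma nnbounded_comp d d' (T : measurableType d) (T' : measurableType d')
    (f : T' -> T) (g : T -> R) B :
  measurable_fun setT f -> nnbounded B g -> nnbounded B (g \o f).
Proof. by move=> mf [mg gB]; split => [|x]; [exact: measurableT_comp|exact: gB]. Qed.

Lemma integrable_nnbounded d (T : measurableType d) (P : probability T R) B (g : T -> R) :
  nnbounded B g -> P.-integrable setT (EFin \o g).
Proof.
move=> [mg gB]; apply: measurable_bounded_integrable => //.
  by rewrite (le_lt_trans (probability_le1 _ _))// ltry.
exists B; split; first exact: num_real.
move=> b Bb x _; have /andP[g0 gb] := gB x.
by rewrite /= ger0_norm// (le_trans gb)// ltW.
Qed.

Lemma Rintegral_nnbounded d (T : measurableType d) (P : probability T R) B (g : T -> R) :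
  nnbounded B g -> 0 <= \int[P]_x g x <= B.
Proof.
move=> gB; have ig := integrable_nnbounded P gB; case: gB => mg gB.
rewrite Rintegral_ge0/=; last by move=> x _; have /andP[] := gB x.
apply: (@le_trans _ _ (\int[P]_x B)).
  apply: le_Rintegral => //.
    exact: finite_measure_integrable_cst.
  by move=> x _; have /andP[] := gB x.
by rewrite Rintegral_cst//= probability_setT mulr1.
Qed.

Lemma measurable_shift r x : measurable_fun setT (fun y : measurableTypeR R => (x - r * y)%R).
Proof. by apply: measurable_funB => //; exact: measurable_funM. Qed.

Lemma nnbounded_shift B g r x : nnbounded B g ->
  nnbounded B (fun y : measurableTypeR R => g (x - r * y)).
Proof. by move=> gB; exact: (nnbounded_comp (measurable_shift r x) gB). Qed.

Lemma avgE m r B g x : nnbounded B g ->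
  (avg m r g x)%:E = (\int[m]_y (g (x - r * y))%:E)%E.
Proof.
move=> gB; rewrite /avg /Rintegral fineK//.
apply: integrable_fin_num => //.
exact: (integrable_nnbounded m (nnbounded_shift r x gB)).
Qed.

Lemma avg_bound m r B g x : nnbounded B g -> 0 <= avg m r g x <= B.
Proof. by move=> gB; exact: (Rintegral_nnbounded m (nnbounded_shift r x gB)). Qed.

Lemma avg_nnbounded m r B g : nnbounded B g -> nnbounded B (avg m r g).
Proof.
move=> gB; split=> [|x]; last exact: avg_bound.
apply/measurable_EFinP.
rewrite [X in measurable_fun _ X](_ : _ = fubini_F m
  (fun z : measurableTypeR R * measurableTypeR R => (g (z.1 - r * z.2))%:E)); last first.
  by apply/funext => x /=; rewrite (avgE _ _ _ gB).
apply: measurable_fun_fubini_tonelli_F.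
  apply/measurable_EFinP; apply: measurableT_comp; first by case: gB.
  by apply: measurable_funB => //; exact: measurable_funM.
by move=> z; rewrite lee_fin; have /andP[] := gB.2 (z.1 - r * z.2).
Qed.

Lemma avgC m n r q B g x : nnbounded B g ->
  avg m r (avg n q g) x = avg n q (avg m r g) x.
Proof.
move=> gB; apply: EFin_inj.
rewrite (avgE _ _ _ (avg_nnbounded n q gB)) (avgE _ _ _ (avg_nnbounded m r gB)).
under eq_integral do rewrite (avgE _ _ _ gB).
under [RHS]eq_integral do rewrite (avgE _ _ _ gB).
rewrite (@fubini_tonelli _ _ _ _ _ m n (fun z => (g (x - r * z.1 - q * z.2))%:E)).
- apply: eq_integral => z _; apply: eq_integral => y _ /=; congr (g _)%:E; ring.
- apply/measurable_EFinP; apply: measurableT_comp; first by case: gB.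
  by apply: measurable_funB; [apply: measurable_funB => //|]; exact: measurable_funM.
- by move=> z; rewrite lee_fin; have /andP[] := gB.2 (x - r * z.1 - q * z.2).
Qed.

Lemma avg0 m g x : avg m 0 g x = g x.
Proof.
rewrite /avg; under eq_Rintegral do rewrite mul0r subr0.
by rewrite Rintegral_cst//= probability_setT mulr1.
Qed.

Lemma eq_avg m r g g' x : g =1 g' -> avg m r g x = avg m r g' x.
Proof. by move=> gg; apply: eq_Rintegral => y _; exact: gg. Qed.

Lemma integrable_shift m B g r x : nnbounded B g ->
  m.-integrable setT (EFin \o (fun y => g (x - r * y))).
Proof. by move=> gB; exact: (integrable_nnbounded m (nnbounded_shift r x gB)). Qed.

Lemma avgZ m r B g a x : nnbounded B g ->
  avg m r (fun y => a * g y) x = a * avg m r g x.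
Proof. by move=> gB; rewrite /avg RintegralZl//; exact: integrable_shift gB. Qed.

Lemma avgD m r B B' g g' x : nnbounded B g -> nnbounded B' g' ->
  avg m r (fun y => g y + g' y) x = avg m r g x + avg m r g' x.
Proof.
move=> gB gB'; rewrite /avg RintegralD//.
- exact: integrable_shift gB.
- exact: integrable_shift gB'.
Qed.

Lemma nnboundedZ B g a : 0 <= a -> nnbounded B g -> nnbounded (a * B) (fun y => a * g y).
Proof.
move=> a0 [mg gB]; split => [|x]; first exact: measurable_funM.
by have /andP[? ?] := gB x; rewrite mulr_ge0//= ler_wpM2l.
Qed.

End avg.

Local Open Scope ring_scope.

(** * The semigroup of centred Gaussian averages *)

Definition std_gauss {R : realType} : probability (measurableTypeR R) R :=
  @normal_prob R 0 1.

Section gauss.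
Context {R : realType}.
Local Notation leb := (@lebesgue_measure R).
Local Notation phi := (@normal_pdf R 0 1).
Local Notation gauss := (@std_gauss R).

Lemma std_normal_pdfE x : phi x = (Num.sqrt (pi *+ 2))^-1 * expR (- x ^+ 2 / 2).
Proof.
by rewrite normal_pdfE ?oner_neq0// /normal_peak /normal_fun expr1n mul1r subr0.
Qed.

Lemma integral_std_normal (g : R -> \bar R) :
  measurable_fun setT g -> (forall x, 0 <= g x)%E ->
  (\int[gauss]_x g x = \int[leb]_x (g x * (phi x)%:E))%E.
Proof.
move=> mg g0; apply: ge0_integral_density => //; first exact: measurable_normal_pdf.
by move=> x; exact: normal_pdf_ge0.
Qed.

(** With s^2 = r^2 + q^2, clearing q^2 turns both exponents into s^2 (v^2 + z^2) - 2 r s v z, which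
    is symmetric in v and z. The exchange isolates z in a single Gaussian factor that integrates to
    a constant. *)
Lemma std_normal_pdf_rotate (r q z v : R) : 0 < q ->
  phi ((Num.sqrt (r ^+ 2 + q ^+ 2) * v - r * z) / q) * phi z =
  phi ((Num.sqrt (r ^+ 2 + q ^+ 2) * z - r * v) / q) * phi v.
Proof.
move=> q0; rewrite !std_normal_pdfE.
rewrite mulrACA [RHS]mulrACA -!expRD; congr (_ * expR _).
set s := Num.sqrt _.
have : s ^+ 2 = r ^+ 2 + q ^+ 2 by rewrite sqr_sqrtr// addr_ge0 ?sqr_ge0.
move=> s2; have q0' : q != 0 by rewrite gt_eqF.
apply: (mulfI (x := - (q ^+ 2 * 2))); first by rewrite oppr_eq0 mulf_neq0 ?pnatr_eq0 ?sqrf_eq0.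
transitivity ((s * v - r * z) ^+ 2 + q ^+ 2 * z ^+ 2); first by field.
transitivity ((s * z - r * v) ^+ 2 + q ^+ 2 * v ^+ 2); last by field.
by rewrite !sqrrB !exprMn s2; ring.
Qed.

Lemma avg_normal_semigroup (r q B : R) (g : R -> R) (x : R) :
  0 <= r -> 0 <= q -> nnbounded B g ->
  avg gauss r (avg gauss q g) x = avg gauss (Num.sqrt (r ^+ 2 + q ^+ 2)) g x.
Proof.
move=> r0; rewrite le_eqVlt => /predU1P[<- gB|q0 gB].
  rewrite expr0n addr0 sqrtr_sqr ger0_norm//.
  by apply: eq_avg => y; rewrite avg0.
have g0 y : 0 <= g y by have /andP[] := gB.2 y.
have [mg _] := gB.
have mphi : measurable_fun setT phi by exact: measurable_normal_pdf.
have phi0 y : 0 <= phi y by exact: normal_pdf_ge0.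
have maff a b : measurable_fun [set: R] (fun y => a * y + b).
  by apply: measurable_funD => //; exact: measurable_funM.
have msub a : measurable_fun [set: R] (fun y => x - a * y).
  by apply: measurable_funB => //; exact: measurable_funM.
apply: EFin_inj; rewrite (avgE _ _ _ (avg_nnbounded _ _ gB)) (avgE _ _ _ gB).
set s := Num.sqrt _.
have s0 : 0 < s by rewrite sqrtr_gt0 ltr_wpDl ?sqr_ge0 ?exprn_gt0.
have q0' : q != 0 by rewrite gt_eqF.
have sq0 : 0 < s / q by rewrite divr_gt0.
have mgs a : measurable_fun [set: R] (fun y => g (x - a * y)) by exact: measurableT_comp.
rewrite !integral_std_normal//=; first last.
- by move=> y; rewrite lee_fin; have /andP[] := avg_bound gauss q (x - r * y) gB.
- by apply/measurable_EFinP; apply: measurableT_comp => //; apply: (avg_nnbounded _ _ gB).1.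
- by move=> y; rewrite lee_fin.
- exact/measurable_EFinP.
(* The substitution y = (s v - r z) / q turns the argument x - r z - q y of [g] into x - s v, free
   of z; the case q = 0 had to be settled before. After exchanging the integrals, the z-integral
   concerns the density only. *)
transitivity (\int[leb]_z \int[leb]_v
   (g (x - s * v) * (phi ((s * v - r * z) / q) * phi z * (s / q)))%:E)%E.
  apply: eq_integral => z _; rewrite (avgE _ _ _ gB).
  rewrite integral_std_normal//=; first last.
  - by move=> y; rewrite lee_fin.
  - by apply/measurable_EFinP; apply: measurableT_comp => //; apply: measurable_funB => //; exact: measurable_funM.
  rewrite -(@ge0_integral_affine _ (s / q) (- (r * z) / q))//; first last.
  - by move=> y; rewrite -EFinM lee_fin mulr_ge0.
  - apply: emeasurable_funM; apply/measurable_EFinP => //;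
    apply: measurableT_comp => //; apply: measurable_funB => //; exact: measurable_funM.
  rewrite -muleA -EFinM -ge0_integralZr//=; first last.
  - by rewrite lee_fin mulr_ge0// ltW.
  - by move=> v _; rewrite -!EFinM lee_fin mulr_ge0.
  - apply: emeasurable_funM; apply/measurable_EFinP => //.
      by apply: measurableT_comp => //; apply: measurable_funB => //; apply: measurable_funM => //; exact: maff.
    exact: (measurableT_comp mphi (maff _ _)).
  apply: eq_integral => v _; rewrite -!EFinM; congr EFin.
  have -> : x - r * z - q * (s / q * v + - (r * z) / q) = x - s * v by field.
  have -> : s / q * v + - (r * z) / q = (s * v - r * z) / q by field.
  ring.
rewrite (@fubini_tonelli _ _ _ _ _ leb leb (fun zv => (g (x - s * zv.2) *
   (phi ((s * zv.2 - r * zv.1) / q) * phi zv.1 * (s / q)))%:E)).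
- apply: eq_integral => v _ /=.
  transitivity (\int[leb]_z ((g (x - s * v) * phi v * (s / q))%:E *
      (phi (s / q * z + - (r * v) / q))%:E))%E.
    apply: eq_integral => z _; rewrite std_normal_pdf_rotate// -!EFinM; congr EFin.
    have -> : s / q * z + - (r * v) / q = (s * z - r * v) / q by field.
    by rewrite -/s; ring.
  rewrite ge0_integralZl//=; first last.
  - by rewrite lee_fin; apply: mulr_ge0; [exact: mulr_ge0|exact: ltW].
  - by move=> z _; rewrite lee_fin.
  - by apply/measurable_EFinP; exact: (measurableT_comp mphi (maff _ _)).
  rewrite EFinM -muleA [X in (_ * X)%E]muleC.
  rewrite (@ge0_integral_affine _ _ _ (fun y => (phi y)%:E))//.
  - by rewrite integral_normal_pdf mule1 EFinM.
  - exact/measurable_EFinP.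
- apply/measurable_EFinP; apply: measurable_funM.
    apply: measurableT_comp => //; apply: measurable_funB => //; exact: measurable_funM.
  apply: measurable_funM => //; apply: measurable_funM; apply: measurableT_comp => //.
  by apply: measurable_funM => //; apply: measurable_funB; apply: measurable_funM.
- by move=> z; rewrite lee_fin; do ![exact: ltW|exact: g0|exact: phi0|apply: mulr_ge0].
Qed.
End gauss.

(** * Fourth-order expansion of Gaussian averages *)

Local Open Scope ring_scope.

Section exp_taylor.
Context {R : realType}.
Implicit Types t : R.

(** By the mean value theorem g t = h c * t with |c| <= |t|. Successive Taylor remainders of the
    exponential are derivatives of one another, so iterating this bounds them; factorials are given
    up. *)
Lemma taylor_step (g h : R -> R) (n : nat) :
  (forall t, is_derive t 1 g (h t)) -> g 0 = 0 ->
  (forall t, `|h t| <= `|t| ^+ n * expR `|t|) ->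
  forall t, `|g t| <= `|t| ^+ n.+1 * expR `|t|.
Proof.
move=> gh g0 hb t.
have cg : continuous g.
  by move=> x; exact/differentiable_continuous/derivable1_diffP.
have [c ct ->] : exists2 c, `|c| <= `|t| & g t = h c * t.
  have [t0|t0] := leP 0 t.
    have [c ct ge] := MVT_segment t0 (fun x _ => gh x) (continuous_subspaceT cg).
    exists c; last by rewrite -[LHS]subr0 -g0 ge subr0.
    by move: ct; rewrite in_itv/= => /andP[c0 ct]; rewrite !ger0_norm.
  have [c ct ge] := MVT_segment (ltW t0) (fun x _ => gh x) (continuous_subspaceT cg).
  exists c; last by rewrite -[LHS]opprK -[X in - X]sub0r -g0 ge sub0r mulrN opprK.
  by move: ct; rewrite in_itv/= => /andP[c0 ct]; rewrite !ler0_norm ?lerN2// ltW.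
rewrite normrM exprS mulrC -mulrA ler_wpM2l// (le_trans (hb c))//.
by rewrite ler_pM ?exprn_ge0 ?expR_ge0 ?lerXn2r ?nnegrE// ler_expR.
Qed.

Lemma expR_taylor3 t :
  `|expR t - (1 + t + t ^+ 2 / 2 + t ^+ 3 / 6)| <= `|t| ^+ 4 * expR `|t|.
Proof.
pose g1 t : R := expR t - 1.
pose g2 t : R := expR t - (1 + t).
pose g3 t : R := expR t - (1 + t + t ^+ 2 / 2).
pose g4 t : R := expR t - (1 + t + t ^+ 2 / 2 + t ^+ 3 / 6).
have b0 (s : R) : `|expR s| <= `|s| ^+ 0 * expR `|s|.
  by rewrite mul1r ger0_norm ?expR_ge0// ler_expR ler_norm.
have d1 (s : R) : is_derive s 1 g1 (expR s).
  by rewrite /g1; apply: is_derive_eq; rewrite /GRing.scale/=; field.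
have d2 (s : R) : is_derive s 1 g2 (g1 s).
  by rewrite /g2 /g1; apply: is_derive_eq; rewrite /GRing.scale/=; field.
have d3 (s : R) : is_derive s 1 g3 (g2 s).
  by rewrite /g3 /g2; apply: is_derive_eq; rewrite /GRing.scale/=; field.
have d4 (s : R) : is_derive s 1 g4 (g3 s).
  by rewrite /g4 /g3; apply: is_derive_eq; rewrite /GRing.scale/=; field.
apply: (taylor_step d4); first by rewrite /g4 expR0; field.
apply: (taylor_step d3); first by rewrite /g3 expR0; field.
apply: (taylor_step d2); first by rewrite /g2 expR0; field.
by apply: (taylor_step d1); rewrite // /g1 expR0 subrr.
Qed.

End exp_taylor.

Section gauss_taylor.
Context {R : realType}.
Local Notation leb := (@lebesgue_measure R).
Local Notation phi := (@normal_pdf R 0 1).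
Local Notation psi := (@normal_pdf R 0 2).
Local Notation gauss := (@std_gauss R).

Lemma pow4_le_expR (u : R) : 0 <= u -> u ^+ 4 <= 4 ^+ 4 * expR u.
Proof.
move=> u0.
have h : u / 4 <= expR (u / 4) by rewrite (le_trans _ (expR_ge1Dx _))// lerDr.
have -> : expR u = expR (u / 4) ^+ 4 by rewrite -expRM_natr; congr expR; field.
have -> : u ^+ 4 = 4 ^+ 4 * (u / 4) ^+ 4 by field.
by rewrite ler_pM2l// lerXn2r ?nnegrE ?expR_ge0// divr_ge0.
Qed.

(** The factor 3 * 4^4 comes from the pointwise expansion, a further 2 from the peak of N(0, 4)
    being half that of N(0, 1), and exp 5 from comparing the exponents. *)
Definition taylor_cst : R := 6 * 4 ^+ 4 * expR 5.

(** Doubling the standard deviation leaves room for any exponential factor: psi decays only like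
    exp(- z^2 / 8). It thus serves as an integrable majorant for all error terms of the
    expansion. *)
Lemma normal_pdf_dominate (z : R) :
  phi z * ((3 * 4 ^+ 4) * expR (2 * `|z| + 2)) <= taylor_cst * psi z.
Proof.
rewrite std_normal_pdfE normal_pdfE ?pnatr_eq0// /normal_peak /normal_fun subr0.
have -> : (2 : R) ^+ 2 * pi *+ 2 = 2 ^+ 2 * (pi *+ 2) by rewrite -mulrnAr.
rewrite sqrtrM ?sqr_ge0// sqrtr_sqr (@gtr0_norm R 2)// invfM /taylor_cst.
set c := _^-1.
have c0 : 0 <= c by rewrite invr_ge0 sqrtr_ge0.
have -> : c * expR (- z ^+ 2 / 2) * ((3 * 4 ^+ 4) * expR (2 * `|z| + 2)) =
  (3 * 4 ^+ 4) * c * expR (- z ^+ 2 / 2 + (2 * `|z| + 2)) by rewrite (expRD (- z ^+ 2 / 2)); ring.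
have -> : 6 * 4 ^+ 4 * expR 5 * (2^-1 * c * expR (- z ^+ 2 / (2 ^+ 2 *+ 2))) =
  (3 * 4 ^+ 4) * c * expR (5 + - z ^+ 2 / (2 ^+ 2 *+ 2)) by rewrite (expRD 5); field.
apply: ler_wpM2l; first by rewrite mulr_ge0.
rewrite ler_expR -(real_normK (num_real z)).
have -> : ((2 : R) ^+ 2 *+ 2) = 8 by ring.
(* The difference of the exponents is 3/8 (|z| - 8/3)^2 + 1/3. *)
by have := sqr_ge0 (`|z| - 8 / 3); nra.
Qed.

(** The second derivative of phi is (z^2 - 1) phi, and odd orders cancel between the two shifts. The
    bound has to hold for every t and be integrable in z; as no fixed integrable function dominates
    phi (z - t) for all t, the shifted densities themselves appear on the right. *)
Lemma normal_pdf_taylor (z t : R) :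
  `|phi (z - t) + phi (z + t) - 2 * phi z - (z ^+ 2 - 1) * t ^+ 2 * phi z| <=
  t ^+ 4 * (phi (z - t) + phi (z + t) + taylor_cst * psi z).
Proof.
have phi0 y : 0 <= phi y by exact: normal_pdf_ge0.
pose u : R := `|z| + 1.
have u1 : 1 <= u by rewrite lerDr.
have u0 : 0 <= u by exact: le_trans u1.
have zu : z ^+ 2 = (u - 1) ^+ 2 by rewrite addrK real_normK ?num_real.
have eu : u ^+ 4 * expR u <= 4 ^+ 4 * expR (2 * `|z| + 2).
  have -> : 2 * `|z| + 2 = u + u by rewrite /u; ring.
  by rewrite (expRD u u) mulrA ler_wpM2r ?expR_ge0// pow4_le_expR// (le_trans _ u1).
have eu1 : 1 <= expR u by rewrite -expR0 ler_expR (le_trans _ u1).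
have u2 : u ^+ 2 <= u ^+ 4 by rewrite ler_weXn2l.
have u4 : 1 <= u ^+ 4 by rewrite exprn_ege1.
have ue : u ^+ 4 <= u ^+ 4 * expR u by rewrite ler_peMr// (le_trans _ u4).
have [t1|t1] := leP 1 `|t|.
  have tt : 1 <= t ^+ 2 by rewrite -(real_normK (num_real t)) exprn_ege1.
  have tt4 : t ^+ 2 <= t ^+ 4.
    by rewrite -[leRHS]/(t ^+ (2 * 2)) exprM expr2 ler_peMr// (le_trans _ tt).
  have t4 : 1 <= t ^+ 4 by exact: le_trans tt4.
  have P : `|phi (z - t) + phi (z + t) - 2 * phi z - (z ^+ 2 - 1) * t ^+ 2 * phi z| <=
     t ^+ 4 * (phi (z - t) + phi (z + t)) + t ^+ 4 * (phi z * (2 + z ^+ 2 + 1)).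
    have := phi0 (z - t); have := phi0 (z + t); have := phi0 z.
    move: (phi z) (phi (z + t)) (phi (z - t)) => a b c a0 b0 c0.
    have h1 : b <= t ^+ 4 * b by rewrite ler_peMl.
    have h2 : c <= t ^+ 4 * c by rewrite ler_peMl.
    have h3 : a <= t ^+ 4 * a by rewrite ler_peMl.
    have h4 : t ^+ 2 * a <= t ^+ 4 * a by rewrite ler_wpM2r.
    have h5 : z ^+ 2 * (t ^+ 2 * a) <= z ^+ 2 * (t ^+ 4 * a) by rewrite ler_wpM2l ?sqr_ge0.
    have h6 : 0 <= z ^+ 2 * (t ^+ 2 * a) by apply: mulr_ge0; rewrite ?sqr_ge0// mulr_ge0 ?sqr_ge0.
    have h7 : 0 <= t ^+ 2 * a by rewrite mulr_ge0 ?sqr_ge0.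
    rewrite ler_norml; apply/andP; split; lra.
  apply: (le_trans P).
  rewrite [leRHS]mulrDr lerD2l ler_wpM2l// ?(le_trans _ t4)//.
  apply: le_trans (normal_pdf_dominate z); apply: ler_wpM2l => //.
  have h : 2 + z ^+ 2 + 1 <= 3 * u ^+ 4 by rewrite zu; nra.
  lra.
(* For |t| < 1 the ratio phi (z + s) / phi z is an exponential of size controlled by [u], to which
   the cubic Taylor bound applies. *)
have E s : phi (z + s) = phi z * expR (- (z * s) - s ^+ 2 / 2).
  by rewrite !std_normal_pdfE -mulrA -expRD; congr (_ * expR _); rewrite sqrrD; field.
rewrite !E.
pose a : R := - (z * - t) - (- t) ^+ 2 / 2; pose b : R := - (z * t) - t ^+ 2 / 2; rewrite -/a -/b.
have R4 s : `|s| = `|t| ->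
    `|expR (- (z * s) - s ^+ 2 / 2) - (1 + (- (z * s) - s ^+ 2 / 2) +
      (- (z * s) - s ^+ 2 / 2) ^+ 2 / 2 + (- (z * s) - s ^+ 2 / 2) ^+ 3 / 6)| <=
    t ^+ 4 * (4 ^+ 4 * expR (2 * `|z| + 2)).
  move=> st; apply: (le_trans (expR_taylor3 _)).
  pose w : R := - (z * s) - s ^+ 2 / 2; rewrite -/w.
  have wt : `|w| <= `|t| * u.
    apply: (le_trans (ler_normB _ _)); rewrite normrN !normrM st.
    rewrite (@ger0_norm R 2^-1)// /u; have := normr_ge0 t.
    nra.
  have wu : `|w| <= u by rewrite (le_trans wt)// ler_piMl// ltW.
  apply: (@le_trans _ _ ((`|t| * u) ^+ 4 * expR u)).
    by rewrite ler_pM ?exprn_ge0 ?expR_ge0 ?lerXn2r ?nnegrE ?mulr_ge0 ?ler_expR.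
  rewrite exprMn -mulrA -normrX ger0_norm; last by rewrite -[_ ^+ 4]/(t ^+ (2 * 2)) exprM sqr_ge0.
  by apply: ler_wpM2l => //; rewrite -[_ ^+ 4]/(t ^+ (2 * 2)) exprM sqr_ge0.
have Ra := R4 (- t) (normrN t); have Rb := R4 t erefl.
rewrite -/a in Ra; rewrite -/b in Rb.
apply: (@le_trans _ _ (t ^+ 4 * (phi z * ((3 * 4 ^+ 4) * expR (2 * `|z| + 2))))); last first.
  have t40 : 0 <= t ^+ 4 by rewrite -[_ ^+ 4]/(t ^+ (2 * 2)) exprM sqr_ge0.
  apply: ler_wpM2l => //; apply: (le_trans (normal_pdf_dominate z)).
  by rewrite lerDr addr_ge0// mulr_ge0// expR_ge0.
set X := expR a - _ in Ra; set Y := expR b - _ in Rb.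
(* Adding the cubic polynomials in a and b, the terms of order 0 and 2 match the expansion exactly
   and only multiples of t^4 remain. [X], [Y] and this polynomial each cost one 4^4 exp(2 |z| + 2),
   whence the factor 3. *)
have -> : phi z * expR a + phi z * expR b - 2 * phi z - (z ^+ 2 - 1) * t ^+ 2 * phi z =
   phi z * (X + Y + t ^+ 4 * (1/4 - z ^+ 2 / 2 - t ^+ 2 / 24)).
  by rewrite /X /Y /a /b; field.
rewrite normrM (ger0_norm (phi0 z)) [leRHS]mulrCA; apply: ler_wpM2l => //.
have t2 : t ^+ 2 <= 1 by rewrite -(real_normK (num_real t)) exprn_ile1// ltW.
have t20 : 0 <= t ^+ 2 by exact: sqr_ge0.
have z20 : 0 <= z ^+ 2 by exact: sqr_ge0.
have h : `|1 / 4 - z ^+ 2 / 2 - t ^+ 2 / 24| <= 4 ^+ 4 * expR (2 * `|z| + 2).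
  have zu4 : z ^+ 2 <= u ^+ 4 by rewrite zu; nra.
  rewrite (le_trans _ eu)// (le_trans _ ue)// ler_norml; apply/andP; split; lra.
rewrite (le_trans (ler_normD _ _))// normrM (ger0_norm (x := t ^+ 4)); last first.
  by rewrite -[_ ^+ 4]/(t ^+ (2 * 2)) exprM sqr_ge0.
have := ler_normD X Y.
have : t ^+ 4 * `|1 / 4 - z ^+ 2 / 2 - t ^+ 2 / 24| <= t ^+ 4 * (4 ^+ 4 * expR (2 * `|z| + 2)).
  by rewrite ler_wpM2l// -[_ ^+ 4]/(t ^+ (2 * 2)) exprM sqr_ge0.
lra.
Qed.

Lemma normal_pdf_shift (z t : R) : phi (z - t) = normal_pdf t 1 z.
Proof. by rewrite !normal_pdfE ?oner_neq0// /normal_fun subr0. Qed.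

Lemma integrable_normal_pdf_shift (t : R) : leb.-integrable setT (fun z => (phi (z - t))%:E).
Proof.
under eq_fun do rewrite normal_pdf_shift.
exact: integrable_normal_pdf.
Qed.

Lemma Rintegral_normal_pdf (m s : R) : \int[leb]_z normal_pdf m s z = 1.
Proof. by rewrite /Rintegral integral_normal_pdf. Qed.

Lemma integrable_normal_pdf_quad : leb.-integrable setT (fun z => ((z ^+ 2 - 1) * phi z)%:E).
Proof.
apply: (le_integrable measurableT
  (f := fun z : measurableTypeR R => ((z ^+ 2 - 1) * phi z)%:E)
  (g := fun z : measurableTypeR R => (taylor_cst * psi z)%:E)).
- apply/measurable_EFinP; apply: measurable_funM; last exact: measurable_normal_pdf.
  by apply: measurable_funB => //; exact: measurable_funX.
- move=> z _; rewrite /= lee_fin normrM (ger0_norm (normal_pdf_ge0 _ _ _)).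
  rewrite [leRHS]ger0_norm ?mulr_ge0 ?expR_ge0 ?normal_pdf_ge0//.
  rewrite mulrC (le_trans _ (normal_pdf_dominate z))//.
  apply: ler_wpM2l; first exact: normal_pdf_ge0.
  have e1 : 1 + `|z| <= expR `|z| by exact: expR_ge1Dx.
  have -> : 2 * `|z| + 2 = `|z| + `|z| + 2 by ring.
  rewrite (expRD (`|z| + `|z|)) (expRD `|z|); have e2 : 1 <= expR (2 : R) by rewrite -expR0 ler_expR.
  have e3 : z ^+ 2 + 1 <= expR `|z| * expR `|z|.
    by rewrite -(real_normK (num_real z)); have := normr_ge0 z; nra.
  have e4 : z ^+ 2 + 1 <= expR `|z| * expR `|z| * expR 2.
    by rewrite (le_trans e3)// ler_peMr// mulr_ge0 ?expR_ge0.
  have z2 := sqr_ge0 z.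
  have k1 : (1 : R) <= 3 * 4 ^+ 4 by rewrite -natrX -natrM ler1n.
  apply: (@le_trans _ _ (z ^+ 2 + 1)).
    by rewrite ler_norml; apply/andP; split; lra.
  by rewrite (le_trans e4)// ler_peMl// !mulr_ge0 ?expR_ge0.
- by apply: (integrableZl measurableT taylor_cst
    (f := fun z : measurableTypeR R => (psi z)%:E)); exact: integrable_normal_pdf.
Qed.

Lemma integrable_nnboundedM (B : R) (k f : R -> R) : nnbounded B k ->
  leb.-integrable setT (EFin \o f) -> leb.-integrable setT (fun z => (k z * f z)%:E).
Proof.
move=> [mk kB] fi.
suff : leb.-integrable setT ((EFin \o k) \* (EFin \o f))%E by apply: eq_integrable.
apply: integrableMr => //.
exists B; split; first exact: num_real.
move=> b Bb x _; have /andP[k0 kb] := kB x.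
by rewrite /= ger0_norm// (le_trans kb)// ltW.
Qed.

(** The pointwise expansion of the density is integrated against [k], which need not be regular
    because the shift acts on phi alone. The three densities in the majorant have mass 1, giving 1 +
    1 + [taylor_cst]. *)
Lemma gauss_shift_taylor (B : R) (k : R -> R) : nnbounded B k ->
  forall t,
  `|\int[leb]_z (k z * phi (z - t)) + \int[leb]_z (k z * phi (z + t)) -
    2 * \int[leb]_z (k z * phi z) - \int[leb]_z (k z * ((z ^+ 2 - 1) * phi z)) * t ^+ 2| <=
   B * (2 + taylor_cst) * t ^+ 4.
Proof.
move=> kB t.
have B0 : 0 <= B by have /andP[] := kB.2 0; exact: le_trans.
have i1 := integrable_normal_pdf_shift t.
have i2 : leb.-integrable setT (fun z => (phi (z + t))%:E).
  by have := integrable_normal_pdf_shift (- t); under eq_fun do rewrite opprK.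
have i3 := @integrable_normal_pdf R 0 1.
have i4 := integrable_normal_pdf_quad.
have i5 := @integrable_normal_pdf R 0 2.
have j1 := integrable_nnboundedM kB i1; have j2 := integrable_nnboundedM kB i2.
have j3 := integrable_nnboundedM kB i3; have j4 := integrable_nnboundedM kB i4.
have j32 : leb.-integrable setT (EFin \o (fun z => 2 * (k z * phi z))).
  by apply: (integrableZl measurableT 2 j3).
have j4t : leb.-integrable setT (EFin \o (fun z => k z * ((z ^+ 2 - 1) * phi z) * t ^+ 2)).
  by apply: (integrableZr measurableT (t ^+ 2) j4).
have j12 : leb.-integrable setT (EFin \o (fun z => k z * phi (z - t) + k z * phi (z + t))).
  exact: (integrableD measurableT j1 j2).
have j123 : leb.-integrable setT (EFin \o (fun z => k z * phi (z - t) + k z * phi (z + t) - 2 * (k z * phi z))).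
  exact: (integrableB measurableT j12 j32).
rewrite -RintegralZr// -RintegralZl// -RintegralD// -RintegralB// -RintegralB//.
have i12 : leb.-integrable setT (EFin \o (fun z => phi (z - t) + phi (z + t))).
  exact: (integrableD measurableT i1 i2).
have i5' : leb.-integrable setT (EFin \o (fun z => taylor_cst * psi z)).
  exact: (integrableZl measurableT taylor_cst i5).
have jt : leb.-integrable setT (EFin \o (fun z => (B * t ^+ 4) * (phi (z - t) + phi (z + t) + taylor_cst * psi z))).
  exact: (integrableZl measurableT (B * t ^+ 4) (integrableD measurableT i12 i5')).
have jq := integrableB measurableT j123 j4t.
apply: (le_trans (le_normr_Rintegral measurableT jq)).
apply: (le_trans (le_Rintegral measurableT (integrable_norm jq) jt _)).
  move=> z _ /=.
  have -> : k z * phi (z - t) + k z * phi (z + t) - 2 * (k z * phi z) - k z * ((z ^+ 2 - 1) * phi z) * t ^+ 2 =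
    k z * (phi (z - t) + phi (z + t) - 2 * phi z - (z ^+ 2 - 1) * t ^+ 2 * phi z) by ring.
  have /andP[k0 kb] := kB.2 z.
  by rewrite normrM (ger0_norm k0) -[leRHS]mulrA; apply: ler_pM => //; exact: normal_pdf_taylor.
rewrite RintegralZl//; last exact: (integrableD measurableT i12 i5').
rewrite (RintegralD measurableT i12 i5') (RintegralD measurableT i1 i2).
rewrite (@RintegralZl _ _ _ leb setT psi taylor_cst measurableT i5).
have e1 : \int[leb]_z phi (z - t) = 1.
  apply: etrans (Rintegral_normal_pdf t 1).
  by apply: eq_Rintegral => z _; exact: normal_pdf_shift.
have e2 : \int[leb]_z phi (z + t) = 1.
  apply: etrans (Rintegral_normal_pdf (- t) 1).
  by apply: eq_Rintegral => z _; rewrite -(normal_pdf_shift z (- t)) opprK.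
have e3 := Rintegral_normal_pdf 0 2.
rewrite e1 e2 e3.
by rewrite le_eqVlt; apply/orP; left; apply/eqP; ring.
Qed.

End gauss_taylor.

Local Open Scope ring_scope.

(** * Exchanging symmetric laws of equal variance under a Gaussian average *)

Section swap.
Context {R : realType}.
Local Notation leb := (@lebesgue_measure R).
Local Notation phi := (@normal_pdf R 0 1).
Local Notation gauss := (@std_gauss R).
Implicit Types (m n : probability (measurableTypeR R) R).

Definition symmetric_law m := forall (B : R) (h : R -> R), nnbounded B h ->
  \int[m]_y h y = \int[m]_y h (- y).

Definition moment m k : R := \int[m]_y y ^+ k.

(** A change of variable moves the translation from [g], which may be irregular, to the smooth
    density. *)
Lemma avg_gauss_shift (r B : R) (g : R -> R) (x u : R) : 0 < r -> nnbounded B g ->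
  avg gauss r g (x - u) = \int[leb]_z (g (x - r * z) * phi (z - u / r)).
Proof.
move=> r0 gB; have r0' : r != 0 by rewrite gt_eqF.
rewrite /avg /Rintegral; congr fine.
have mk y : measurable_fun [set: R] (fun z => (g (y - r * z))%:E).
  by apply/measurable_EFinP; exact: (nnbounded_shift r y gB).1.
have g0 y : 0 <= g y by have /andP[] := gB.2 y.
have g1 z : (0 <= (g (x - u - r * z))%:E)%E by rewrite lee_fin.
rewrite (integral_std_normal (mk (x - u)) g1).
have mphi : measurable_fun [set: R] (fun z => (phi z)%:E).
  by apply/measurable_EFinP; exact: measurable_normal_pdf.
rewrite -(@ge0_integral_affine _ 1 (- (u / r)))//; first last.
- by move=> z; rewrite -EFinM lee_fin mulr_ge0// normal_pdf_ge0.
- exact: emeasurable_funM.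
rewrite mule1; apply: eq_integral => z _; rewrite -EFinM mul1r; congr (g _ * _)%:E.
by field.
Qed.

(** The order of quantifiers matters: [al] and [ga] are fixed before the law [m] and the scale [c],
    so two laws with the same scaled variance share the whole main part and differ only by
    fourth-moment errors. *)
Lemma avg_gauss_taylor (r B : R) (g : R -> R) (x : R) : 0 < r -> nnbounded B g ->
  exists al ga, forall m c, symmetric_law m ->
    m.-integrable setT (fun y => (y ^+ 2)%:E) -> m.-integrable setT (fun y => (y ^+ 4)%:E) ->
  `|avg m c (avg gauss r g) x - al - ga * (c ^+ 2 * moment m 2)| <=
    B * (1 + taylor_cst / 2) * (c ^+ 4 * moment m 4) / r ^+ 4.
Proof.
move=> r0 gB; have := gauss_shift_taylor (nnbounded_shift r x gB).
set al := 2 * _; set ga := \int[leb]_z (_ * ((_ ^+ 2 - 1) * _)) => H.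
have r0' : r != 0 by rewrite gt_eqF.
exists (al / 2), (ga / 2 / r ^+ 2) => m c sm i2 i4.
have GB := avg_nnbounded gauss r gB.
set G := avg gauss r g in GB *.
have hB := nnbounded_shift c x GB.
have hB' : nnbounded B (fun y : measurableTypeR R => G (x + c * y)).
  have := nnbounded_shift (- c) x GB.
  by congr nnbounded; apply/funext => y; rewrite mulNr opprK.
have i1 := integrable_nnbounded m hB.
have i1' := integrable_nnbounded m hB'.
have i11 := integrableD measurableT i1 i1'.
(* Symmetry of [m] replaces G (x - c y) by the mean of the two opposite shifts, which is the form
   the expansion requires and the origin of the halves. *)
have e1 : avg m c G x = 2^-1 * \int[m]_y (G (x - c * y) + G (x + c * y)).
  rewrite RintegralD// /avg.
  have -> : \int[m]_y G (x + c * y) = \int[m]_y G (x - c * y).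
    rewrite (sm _ _ hB); apply: eq_Rintegral => y _; congr G; ring.
  by field.
pose q y := G (x - c * y) + G (x + c * y) - al - ga / r ^+ 2 * c ^+ 2 * y ^+ 2.
have ia : m.-integrable setT (EFin \o (fun=> al)) by exact: finite_measure_integrable_cst.
have ig : m.-integrable setT (EFin \o (fun y => ga / r ^+ 2 * c ^+ 2 * y ^+ 2)).
  exact: (integrableZl measurableT _ i2).
have i11a := integrableB measurableT i11 ia.
have iq : m.-integrable setT (EFin \o q).
  exact: (integrableB measurableT i11a ig).
have -> : avg m c G x - al / 2 - ga / 2 / r ^+ 2 * (c ^+ 2 * moment m 2) = 2^-1 * \int[m]_y q y.
  rewrite RintegralB// RintegralB// (@RintegralZl _ _ _ m setT (fun y => y ^+ 2) _ measurableT i2).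
  rewrite Rintegral_cst// (_ : fine (m setT) = 1) ?mulr1; last by rewrite probability_setT.
  by rewrite e1 /moment; field.
rewrite normrM ger0_norm ?invr_ge0//.
have ib : m.-integrable setT (EFin \o (fun y => B * (2 + taylor_cst) * (c ^+ 4 / r ^+ 4) * y ^+ 4)).
  exact: (integrableZl measurableT _ i4).
apply: (@le_trans _ _ (2^-1 * \int[m]_y (B * (2 + taylor_cst) * (c ^+ 4 / r ^+ 4) * y ^+ 4))); last first.
  rewrite RintegralZl// /moment le_eqVlt; apply/orP; left; apply/eqP; by field.
rewrite ler_pM2l ?invr_gt0//; apply: (le_trans (le_normr_Rintegral measurableT iq)).
apply: (le_Rintegral measurableT (integrable_norm iq) ib) => y _.
have := H (c * y / r); rewrite /= /q.
have E1 := avg_gauss_shift x (c * y) r0 gB; have E2 := avg_gauss_shift x (- (c * y)) r0 gB.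
rewrite -/G in E1; rewrite -/G opprK in E2; rewrite E1 E2.
have -> : \int[leb]_z (g (x - r * z) * phi (z + c * y / r)) =
   \int[leb]_z (g (x - r * z) * phi (z - - (c * y) / r)).
  by apply: eq_Rintegral => z _; rewrite mulNr opprK.
have -> : ga * (c * y / r) ^+ 2 = ga / r ^+ 2 * c ^+ 2 * y ^+ 2 by field.
have -> // : B * (2 + taylor_cst) * (c * y / r) ^+ 4 =
  B * (2 + taylor_cst) * (c ^+ 4 / r ^+ 4) * y ^+ 4 by field.
Qed.

Lemma avg_swap (m n : probability (measurableTypeR R) R) (c e r B : R) (g : R -> R) (x : R) :
  0 < r -> nnbounded B g -> symmetric_law m -> symmetric_law n ->
  m.-integrable setT (fun y => (y ^+ 2)%:E) -> m.-integrable setT (fun y => (y ^+ 4)%:E) ->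
  n.-integrable setT (fun y => (y ^+ 2)%:E) -> n.-integrable setT (fun y => (y ^+ 4)%:E) ->
  c ^+ 2 * moment m 2 = e ^+ 2 * moment n 2 ->
  `|avg m c (avg gauss r g) x - avg n e (avg gauss r g) x| <=
    B * ((1 + taylor_cst / 2) * (c ^+ 4 * moment m 4 + e ^+ 4 * moment n 4)) / r ^+ 4.
Proof.
move=> r0 gB sm sn m2 m4 n2 n4 v; have [al [ga H]] := avg_gauss_taylor x r0 gB.
have := H m c sm m2 m4; have := H n e sn n2 n4; rewrite v.
set a := avg m _ _ _; set b := avg n _ _ _ => Hb Ha.
have -> : a - b = (a - al - ga * (e ^+ 2 * moment n 2)) - (b - al - ga * (e ^+ 2 * moment n 2)).
  by ring.
rewrite (le_trans (ler_normB _ _))// (le_trans (lerD Ha Hb))//.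
rewrite le_eqVlt; apply/orP; left; apply/eqP; field.
by rewrite gt_eqF.
Qed.

End swap.

(** * Gaussian and logistic moments *)

Local Open Scope ring_scope.

Section densities.
Context {R : realType}.
Local Notation leb := (@lebesgue_measure R).
Local Notation phi := (@normal_pdf R 0 1).
Local Notation psi := (@normal_pdf R 0 2).
Local Notation gauss := (@std_gauss R).
Implicit Types (m : probability (measurableTypeR R) R).

Definition has_density m (f : R -> R) :=
  forall B, measurable B -> m B = (\int[leb]_(x in B) (f x)%:E)%E.

Lemma ge0_integral_has_density m (f : R -> R) (g : R -> \bar R) :
  measurable_fun setT f -> (forall x, 0 <= f x) -> has_density m f ->
  measurable_fun setT g -> (forall x, 0 <= g x)%E ->
  (\int[m]_x g x = \int[leb]_x (g x * (f x)%:E))%E.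
Proof.
move=> mf f0 mfE mg g0.
exact: (@ge0_integral_density R _ (measurableTypeR R) m leb f g mf f0 mfE mg g0).
Qed.

Lemma ge0_integral_opp (g : R -> \bar R) :
  measurable_fun setT g -> (forall x, 0 <= g x)%E ->
  (\int[leb]_x g (- x)%R = \int[leb]_x g x)%E.
Proof.
move=> mg g0.
have mN : measurable_fun [set: measurableTypeR R] (-%R : _ -> measurableTypeR R) by [].
transitivity (\int[pushforward leb (-%R : _ -> measurableTypeR R)]_x g x)%E.
  by rewrite ge0_integral_pushforward.
by apply: eq_measure_integral => A mA _; exact: lebesgue_measureN.
Qed.

Lemma symmetric_density m (f : R -> R) : measurable_fun setT f ->
  (forall x, 0 <= f x) -> (forall x, f (- x) = f x) -> has_density m f -> symmetric_law m.
Proof.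
move=> mf f0 fN mfE B h hB; rewrite /Rintegral; congr fine.
have h0 x : 0 <= h x by have /andP[] := hB.2 x.
have mh : measurable_fun [set: R] (fun y => (h y)%:E) by apply/measurable_EFinP; exact: hB.1.
have mhN : measurable_fun [set: R] (fun y => (h (- y))%:E) by exact: (measurableT_comp mh).
have h1 y : (0 <= (h y)%:E)%E by rewrite lee_fin.
have h2 y : (0 <= (h (- y))%:E)%E by rewrite lee_fin.
rewrite (ge0_integral_has_density mf f0 mfE mh h1) (ge0_integral_has_density mf f0 mfE mhN h2).
rewrite -(@ge0_integral_opp (fun y => (h y)%:E * (f y)%:E)%E).
- by apply: eq_integral => y _; rewrite fN.
- by apply: emeasurable_funM => //; exact/measurable_EFinP.
- by move=> y; rewrite -EFinM lee_fin mulr_ge0.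
Qed.

Lemma gauss_density : has_density gauss phi.
Proof. by []. Qed.

Lemma gauss_symmetric : symmetric_law gauss.
Proof.
apply: symmetric_density gauss_density; first exact: measurable_normal_pdf.
  by move=> x; exact: normal_pdf_ge0.
by move=> x; rewrite !std_normal_pdfE sqrrN.
Qed.

Lemma moment_integrable_density m (f F : R -> R) k C :
  measurable_fun setT f -> (forall x, 0 <= f x) -> has_density m f ->
  leb.-integrable setT (EFin \o F) -> (forall x, `|x ^+ k| * f x <= C * F x) ->
  m.-integrable setT (fun y => (y ^+ k)%:E).
Proof.
move=> mf f0 mfE iF fF; apply/integrableP; split.
  by apply/measurable_EFinP; exact: measurable_funX.
have mX : measurable_fun [set: R] (fun y => (`|y ^+ k|)%:E).
  by apply/measurable_EFinP; apply: measurableT_comp => //; exact: measurable_funX.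
have X0 (y : R) : (0 <= (`|y ^+ k|)%:E)%E by rewrite lee_fin.
rewrite (ge0_integral_has_density mf f0 mfE mX X0).
have iCF := integrableZl measurableT C iF.
apply: (@le_lt_trans _ _ (\int[leb]_x (C%:E * (F x)%:E))%E); last first.
  by rewrite ltey_eq; apply/orP; left; exact: (integrable_fin_num measurableT iCF).
apply: ge0_le_integral => //.
- by move=> x _; rewrite mule_ge0// lee_fin.
- by apply: emeasurable_funM => //; exact/measurable_EFinP.
- by have /integrableP[] := iCF.
- by move=> x _; rewrite -!EFinM lee_fin.
Qed.

Lemma integrable_moment2 m : m.-integrable setT (fun y => (y ^+ 4)%:E) ->
  m.-integrable setT (fun y => (y ^+ 2)%:E).
Proof.
move=> i4; have i1 : m.-integrable setT (fun=> 1%:E) by exact: finite_measure_integrable_cst.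
apply: (le_integrable measurableT _ _ (integrableD measurableT i1 i4)).
  by apply/measurable_EFinP; exact: measurable_funX.
move=> y _; rewrite /= lee_fin ger0_norm ?sqr_ge0//.
have -> : y ^+ 4 = (y ^+ 2) ^+ 2 by rewrite -exprM.
rewrite ger0_norm ?addr_ge0 ?sqr_ge0//.
have := sqr_ge0 (y ^+ 2 - 1); have := sqr_ge0 y.
nra.
Qed.

Lemma gauss_moment4_integrable : gauss.-integrable setT (fun y => (y ^+ 4)%:E).
Proof.
apply: (@moment_integrable_density gauss phi psi 4 taylor_cst).
- exact: measurable_normal_pdf.
- by move=> x; exact: normal_pdf_ge0.
- exact: gauss_density.
- exact: integrable_normal_pdf.
move=> z; apply: le_trans (normal_pdf_dominate z).
rewrite mulrC; apply: ler_wpM2l; first exact: normal_pdf_ge0.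
have u0 : 0 <= 2 * `|z| + 2 by rewrite addr_ge0// mulr_ge0.
have := pow4_le_expR u0; rewrite normrX.
have : `|z| ^+ 4 <= (2 * `|z| + 2) ^+ 4.
  by rewrite lerXn2r ?nnegrE//; have := normr_ge0 z; lra.
have : 0 <= 4 ^+ 4 * expR (2 * `|z| + 2) by rewrite mulr_ge0 ?expR_ge0.
lra.
Qed.

(* For k = 1 the left-hand side of gauss_shift_taylor is -ga * t ^ 2, while its
   right-hand side is O(t ^ 4): the coefficient ga = E[Z ^ 2 - 1] vanishes. *)
Lemma gauss_moment2 : moment gauss 2 = 1.
Proof.
have h1 : nnbounded 1 (fun _ : measurableTypeR R => 1 : R).
  by split => // x; rewrite ler01 lexx.
have H := gauss_shift_taylor h1.
have Hm s : \int[leb]_z (1 * normal_pdf s 1 z) = 1.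
  by under eq_Rintegral do rewrite mul1r; exact: Rintegral_normal_pdf.
have Hs t : \int[leb]_z (1 * phi (z - t)) = 1.
  by rewrite -[RHS](Hm t); apply: eq_Rintegral => z _; rewrite normal_pdf_shift.
have Hs' t : \int[leb]_z (1 * phi (z + t)) = 1.
  by rewrite -[RHS](Hs (- t)); apply: eq_Rintegral => z _; rewrite opprK.
set c := 1 * (2 + taylor_cst) in H.
set ga := \int[leb]_z (1 * ((z ^+ 2 - 1) * phi z)) in H.
have ga0 : ga = 0.
  have c0 : 0 < c by rewrite /c mul1r ltr_pwDl// /taylor_cst mulr_ge0 ?expR_ge0.
  have K t : `|ga| * t ^+ 2 <= c * t ^+ 4.
    have := H t; rewrite Hs Hs' Hm mulr1 -[2 - 2]/(_ : R).
    have -> : 1 + 1 - 2 - ga * t ^+ 2 = - (ga * t ^+ 2) by ring.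
    by rewrite normrN normrM [X in _ * X]ger0_norm ?sqr_ge0.
  apply/eqP; apply: contraT => ga0.
  have g0 : 0 < `|ga| by rewrite normr_gt0.
  (* This t makes [c * t ^+ 4] half of |ga| t^2, contradicting [K]. *)
  pose t := Num.sqrt (`|ga| / (2 * c)).
  have t2 : t ^+ 2 = `|ga| / (2 * c) by rewrite sqr_sqrtr// divr_ge0// mulr_ge0// ltW.
  have := K t; have -> : t ^+ 4 = (t ^+ 2) ^+ 2 by rewrite -exprM.
  rewrite t2.
  have -> : c * (`|ga| / (2 * c)) ^+ 2 = `|ga| * (`|ga| / (2 * c)) / 2 by field; rewrite gt_eqF.
  have : 0 < `|ga| * (`|ga| / (2 * c)) by rewrite mulr_gt0// divr_gt0// mulr_gt0.
  lra.
have i2 := integrable_moment2 gauss_moment4_integrable.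
have mX : measurable_fun [set: R] (fun y => (y ^+ 2)%:E).
  by apply/measurable_EFinP; exact: measurable_funX.
have X0 (y : R) : (0 <= (y ^+ 2)%:E)%E by rewrite lee_fin sqr_ge0.
transitivity (\int[leb]_z ((z ^+ 2 - 1) * phi z + phi z)).
  rewrite /moment /Rintegral; congr fine; rewrite (integral_std_normal mX X0).
  by apply: eq_integral => y _; rewrite -EFinM; congr EFin; ring.
rewrite (RintegralD measurableT integrable_normal_pdf_quad (integrable_normal_pdf 0 1)).
rewrite Rintegral_normal_pdf -[RHS]add0r; congr (_ + _); apply: etrans ga0.
by apply: eq_Rintegral => z _; rewrite mul1r.
Qed.

Section logistic.
Variable m : probability (measurableTypeR R) R.
Hypothesis mE : has_density m logistic_pdf.

Lemma logistic_pdf_ge0 (x : R) : 0 <= logistic_pdf x.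
Proof. by rewrite /logistic_pdf divr_ge0 ?expR_ge0// sqr_ge0. Qed.

Lemma logistic_pdfN (x : R) : logistic_pdf (- x) = logistic_pdf x.
Proof.
rewrite /logistic_pdf opprK.
have e0 : expR x != 0 by rewrite gt_eqF ?expR_gt0.
have e1 : 1 + expR x != 0 by rewrite gt_eqF// ltr_pwDl ?expR_ge0.
rewrite expRN; field.
by rewrite e0 addrC e1.
Qed.

(** The density is even, and for x >= 0 its denominator lies between 1 and 4. *)
Lemma logistic_pdf_bounds (x : R) :
  expR (- `|x|) / 4 <= logistic_pdf x <= expR (- `|x|).
Proof.
have -> : logistic_pdf x = logistic_pdf `|x|.
  by have [_|_] := ger0P x; rewrite ?logistic_pdfN.
rewrite /logistic_pdf; set e := expR (- `|x|).
have e0 : 0 < e by exact: expR_gt0.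
have e1 : e <= 1 by rewrite -expR0 ler_expR oppr_le0.
have e2 : 0 < (1 + e) ^+ 2 by rewrite exprn_gt0// addr_gt0.
rewrite ler_pM2l// lef_pV2 ?posrE// ler_pdivrMr//.
apply/andP; split; nra.
Qed.

Lemma continuous_logistic_pdf : continuous (@logistic_pdf R).
Proof.
move=> x; have cE : expR (- y) @[y --> x] --> expR (- x).
  apply: (@cvg_comp _ _ _ (fun x : R => - x) expR); last exact: continuous_expR.
  by apply: cvgN; exact: cvg_id.
apply: cvgM => //; apply: cvgV; first by rewrite sqrf_eq0 gt_eqF// ltr_pwDl// expR_ge0.
apply: (@cvg_comp _ _ _ (fun x : R => 1 + expR (- x)) (fun y => y ^+ 2)); last exact: sqr_continuous.
by apply: cvgD => //; exact: cvg_cst.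
Qed.

Lemma measurable_logistic_pdf : measurable_fun [set: R] (@logistic_pdf R).
Proof. exact: continuous_measurable_fun continuous_logistic_pdf. Qed.

Lemma logistic_symmetric : symmetric_law m.
Proof.
apply: symmetric_density mE; [exact: measurable_logistic_pdf|exact: logistic_pdf_ge0|].
exact: logistic_pdfN.
Qed.

(** From (|x| - 1)^2 >= 0 follows exp(- x^2 / 2) <= exp(1/2 - |x|) <= 2 exp(- |x|), and the
    normalising factor of phi is at most 1. The lower bound exp(- |x|) / 4 of the logistic density
    turns this 2 into the ratio 1/8. *)
Lemma logistic_pdf_gauss (x : R) : phi x / 8 <= logistic_pdf x.
Proof.
have /andP[h _] := logistic_pdf_bounds x; apply: le_trans h.
have : phi x <= 2 * expR (- `|x|).
  rewrite std_normal_pdfE.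
  have p2 : 2 <= (pi : R) by exact: pi_ge2.
  have s1 : (Num.sqrt (pi *+ 2 : R))^-1 <= 1.
    have s2 : 1 <= Num.sqrt (pi *+ 2 : R).
      by rewrite -[leLHS]sqrtr1 ler_sqrt mulr2n; lra.
    by rewrite invf_le1// (lt_le_trans ltr01).
  have e2 : expR (- x ^+ 2 / 2) <= 2 * expR (- `|x|).
    have : expR (- x ^+ 2 / 2) <= expR (2^-1 - `|x|).
      rewrite ler_expR -(real_normK (num_real x)).
      by have := sqr_ge0 (`|x| - 1); nra.
    move=> h; apply: (le_trans h); rewrite expRD ler_wpM2r ?expR_ge0//.
    have k := @expR_ge1Dx R (- 2^-1); have e := expR_gt0 (2^-1 : R).
    by rewrite expRN -(ler_pM2r e) mulVf ?gt_eqF// in k; lra.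
  rewrite (le_trans _ e2)// ler_piMl ?expR_ge0//.
lra.
Qed.

(** Half of the exponential decay absorbs x^4; what remains is comparable to the logistic density at
    x / 2, whose integral is finite by scaling. The constant is 16 * 4^4 times the 4 from the lower
    density bound. *)
Lemma logistic_moment4_integrable : m.-integrable setT (fun y => (y ^+ 4)%:E).
Proof.
have mf := measurable_logistic_pdf; have f0 := logistic_pdf_ge0.
apply: (@moment_integrable_density m logistic_pdf (fun x => logistic_pdf (2^-1 * x + 0)) 4 (64 * 4 ^+ 4)) => //.
- have mh : measurable_fun [set: R] (fun x => logistic_pdf (2^-1 * x + 0)).
    by apply: measurableT_comp => //; apply: measurable_funD => //; exact: measurable_funM.
  apply/integrableP; split; first exact/measurable_EFinP.
  under eq_integral do rewrite /= ger0_norm//.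
  have : (\int[leb]_x (logistic_pdf (2^-1 * x + 0))%:E * 2^-1%:E = 1)%E.
    rewrite (@ge0_integral_affine R 2^-1 0 (fun x => (logistic_pdf x)%:E))//.
    - by rewrite -(mE measurableT) probability_setT.
    - exact/measurable_EFinP.
  set I := (\int[leb]_x _)%E; case: I => //.
  + by move=> r _; exact: ltry.
  + by rewrite gt0_mulye ?lte_fin// => /eqP.
- move=> x; rewrite addr0; have /andP[_ h1] := logistic_pdf_bounds x.
  have /andP[h2 _] := logistic_pdf_bounds (2^-1 * x).
  rewrite normrX.
  have e : `|2^-1 * x| = `|x| / 2 by rewrite normrM ger0_norm// mulrC.
  rewrite e in h2.
  have u0 : 0 <= `|x| / 2 by rewrite divr_ge0.
  have k := pow4_le_expR u0.
  have -> : `|x| ^+ 4 = 16 * (`|x| / 2) ^+ 4 by field.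
  apply: (@le_trans _ _ (16 * (4 ^+ 4 * expR (`|x| / 2)) * expR (- `|x|))).
    by rewrite ler_pM ?mulr_ge0 ?exprn_ge0// ler_pM2l.
  have -> : 16 * (4 ^+ 4 * expR (`|x| / 2)) * expR (- `|x|) =
    64 * 4 ^+ 4 * (expR (- (`|x| / 2)) / 4).
    have -> : - `|x| = - (`|x| / 2) + - (`|x| / 2) by field.
    rewrite expRD !expRN; field.
    by rewrite gt_eqF ?expR_gt0.
  by rewrite ler_wpM2l// mulr_ge0// exprn_ge0.
Qed.

Lemma avg_logistic_ge_gauss B (g : R -> R) x : nnbounded B g ->
  8^-1 * avg gauss 1 g x <= avg m 1 g x.
Proof.
move=> gB; rewrite -lee_fin EFinM (avgE _ _ _ gB) (avgE _ _ _ gB).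
have mg : measurable_fun [set: R] (fun y => (g (x - 1 * y))%:E).
  by apply/measurable_EFinP; exact: (nnbounded_shift 1 x gB).1.
have g0 y : (0 <= (g (x - 1 * y))%:E)%E by rewrite lee_fin; have /andP[] := gB.2 (x - 1 * y).
rewrite (integral_std_normal mg g0).
rewrite (ge0_integral_has_density measurable_logistic_pdf logistic_pdf_ge0 mE mg g0).
have mphi : measurable_fun [set: R] (fun z => (phi z)%:E).
  by apply/measurable_EFinP; exact: measurable_normal_pdf.
have mlog : measurable_fun [set: R] (fun z => (logistic_pdf z)%:E).
  by apply/measurable_EFinP; exact: measurable_logistic_pdf.
have p0 y : (0 <= (phi y)%:E)%E by rewrite lee_fin normal_pdf_ge0.
rewrite -ge0_integralZl//; first last.
- by move=> y _; rewrite mule_ge0.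
- exact: emeasurable_funM.
apply: ge0_le_integral => //.
- by move=> y _; rewrite !mule_ge0// lee_fin.
- by apply: emeasurable_funM => //; exact: emeasurable_funM.
- exact: emeasurable_funM.
move=> y _; rewrite muleCA; apply: lee_wpmul2l => //.
by rewrite -EFinM lee_fin mulrC logistic_pdf_gauss.
Qed.

End logistic.

End densities.

(** * The Basel sum and the logistic variance *)

Local Open Scope ring_scope.

Section basel.
Context {R : realType}.
Implicit Types (x : R) (n N : nat).

(** This is sin x = 2 sin(x/2) cos(x/2) together with cos^2 + sin^2 = 1. The cosine is written as
    the sine of the complementary angle so that both terms have the shape occurring in [sin_sum]. *)
Lemma sin_pow_split x : sin x != 0 ->
  (sin x) ^- 2 = ((sin (x / 2)) ^- 2 + (sin (pi / 2 - x / 2)) ^- 2) / 4.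
Proof.
have -> : sin (pi / 2 - x / 2) = cos (x / 2).
  by rewrite sinB sin_pihalf cos_pihalf mul1r mul0r subr0.
have e : sin x = (cos (x / 2) * sin (x / 2)) *+ 2.
  by rewrite -sin_mulr2n -mulr_natr; congr sin; field.
have := cos2Dsin2 (x / 2); rewrite e.
move: (cos (x / 2)) (sin (x / 2)) => c s cs.
rewrite -mulr_natr !mulf_eq0 !negb_or pnatr_eq0 andbT => /andP[c0 s0].
have -> : s ^- 2 + c ^- 2 = (c ^+ 2 + s ^+ 2) / (c ^+ 2 * s ^+ 2).
  by field; rewrite c0 s0.
by rewrite cs; field; rewrite c0 s0.
Qed.

(** On this interval x cos x <= sin x <= x by the mean value theorem, and the left-hand side is the
    squared cotangent. *)
Lemma sin_pow_bounds x : 0 < x < pi / 2 ->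
  (sin x) ^- 2 - 1 <= x ^- 2 <= (sin x) ^- 2.
Proof.
move=> /andP[x0 x2].
have [c cx sx] := MVT_segment (ltW x0) (fun y _ => is_derive_sin y)
  (continuous_subspaceT (@continuous_sin R)).
move: cx; rewrite in_itv/= => /andP[c0 cx]; rewrite sin0 !subr0 in sx.
have xpi : x <= pi by have := pi_ge0 R; lra.
have sin0 : 0 < sin x by apply: sin_gt0_pihalf; rewrite x0.
have cosx : 0 <= cos x.
  by apply: cos_ge0_pihalf; apply/andP; split; have := pi_ge0 R; lra.
have cc : cos x <= cos c.
  move: cx; rewrite le_eqVlt => /predU1P[-> //|cx].
  by apply/ltW; rewrite ltr_cos ?in_itv/= ?(ltW x0) ?c0 ?xpi//; lra.
have cs : sin x <= x by rewrite sx ler_piMl ?(ltW x0)// cos_le1.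
have cs' : cos x * x <= sin x by rewrite sx ler_wpM2r// ltW.
have x20 : 0 < x ^+ 2 by rewrite exprn_gt0.
have s20 : 0 < sin x ^+ 2 by rewrite exprn_gt0.
apply/andP; split; last first.
  by rewrite lef_pV2 ?posrE// lerXn2r// nnegrE ltW.
have -> : (sin x) ^- 2 - 1 = cos x ^+ 2 / sin x ^+ 2.
  by rewrite cos2sin2; field; rewrite gt_eqF.
rewrite ler_pdivrMr// mulrC ler_pdivlMr// -exprMn.
by rewrite lerXn2r ?nnegrE ?mulr_ge0// ltW.
Qed.

(* Hofbauer's proof of the Basel identity: sin_pow_split replaces each angle by
   two angles of half the mesh, so the sum below is known exactly for N = 2^n. *)
Definition sin_sum N : R := \sum_(k < N) (sin (k.*2.+1%:R * pi / (4 * N%:R))) ^- 2.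

Lemma sin_sum_double N : (0 < N)%N -> sin_sum (N + N) = 4 * sin_sum N.
Proof.
move=> N0; have N0' : 0 < N%:R :> R by rewrite ltr0n.
(* The second half of the sum is reversed, so that index k faces the complement of the angle it
   carries in the first half: the two halves of one application of [sin_pow_split]. *)
rewrite /sin_sum big_split_ord/= [X in _ + X](reindex_inj rev_ord_inj)/=.
rewrite -big_split/= mulr_sumr; apply: eq_bigr => k _.
set x := k.*2.+1%:R * pi / (4 * N%:R).
have p0 := pi_gt0 R.
have kN : k.*2.+1%:R < (2 * N)%:R :> R.
  by rewrite ltr_nat mul2n -addnn; have := ltn_ord k; lia.
have x0 : 0 < x by rewrite divr_gt0 ?mulr_gt0.
have x2 : x < pi / 2.
  rewrite /x ltr_pdivrMr ?mulr_gt0//.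
  have -> : pi / 2 * (4 * N%:R) = (2 * N)%:R * pi :> R by rewrite natrM; field.
  by rewrite ltr_pM2r.
have s0 : sin x != 0 by rewrite gt_eqF// sin_gt0_pihalf// x0.
rewrite (sin_pow_split s0) [RHS]mulrC divfK//; congr (_ ^- 2 + _ ^- 2); congr sin.
  by rewrite /x natrD; field; rewrite !gt_eqF ?addr_gt0.
have -> : (N + (N - k.+1)).*2.+1%:R = 4 * N%:R - k.*2.+1%:R :> R.
  apply/eqP; rewrite eq_sym subr_eq -natrD -natrM eqr_nat; apply/eqP.
  by have := ltn_ord k; lia.
by rewrite /x natrD; field; rewrite !gt_eqF ?addr_gt0.
Qed.

Lemma sin_sum_pow2 n : sin_sum (2 ^ n) = 2 * (2 ^ n)%:R ^+ 2.
Proof.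
elim: n => [|n IHn].
  rewrite /sin_sum expn0 big_ord1/= mulr1 mul1r expr1n mulr1.
  have s0 : sin (pi / 2) != 0 :> R by rewrite sin_pihalf oner_neq0.
  have := sin_pow_split s0; rewrite sin_pihalf expr1n invr1.
  have -> : pi / 2 - pi / 2 / 2 = pi / 4 :> R by field.
  have -> : pi / 2 / 2 = pi / 4 :> R by field.
  by move=> h; lra.
rewrite expnS mul2n -addnn sin_sum_double ?expn_gt0// IHn natrD; ring.
Qed.

Definition odd_sum N : R := \sum_(k < N) (k.*2.+1%:R) ^- 2.
Definition zeta_sum N : R := \sum_(k < N) (k.+1%:R) ^- 2.

(** Replacing each inverse squared sine by the inverse squared angle costs at most 1 per term; N
    terms rescaled by pi^2 / (16 N^2) give the error pi^2 / (16 N). *)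
Lemma odd_sum_pow2 n :
  pi ^+ 2 / 8 - pi ^+ 2 / 16 * (2 ^ n)%:R^-1 <= odd_sum (2 ^ n) <= pi ^+ 2 / 8.
Proof.
set N := (2 ^ n)%N; have N0 : 0 < N%:R :> R by rewrite ltr0n expn_gt0.
have p0 := pi_gt0 R.
have E : odd_sum N = pi ^+ 2 / (16 * N%:R ^+ 2) *
    \sum_(k < N) (k.*2.+1%:R * pi / (4 * N%:R)) ^- 2.
  rewrite mulr_sumr; apply: eq_bigr => k _.
  have d0 : 0 < k.*2.+1%:R :> R by rewrite ltr0n.
  move: (k.*2.+1%:R) (pi : R) d0 p0 => d q d0 q0; field; by rewrite !gt_eqF.
pose th (k : nat) : R := k.*2.+1%:R * pi / (4 * N%:R).
have B (k : 'I_N) : (sin (th k)) ^- 2 - 1 <= (th k) ^- 2 <= (sin (th k)) ^- 2.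
  apply: sin_pow_bounds; rewrite /th; apply/andP; split; first by rewrite divr_gt0 ?mulr_gt0.
  rewrite ltr_pdivrMr ?mulr_gt0//.
  have -> : pi / 2 * (4 * N%:R) = (2 * N)%:R * pi :> R by rewrite natrM; field.
  by rewrite ltr_pM2r// ltr_nat mul2n; have := ltn_ord k; lia.
have c0 : 0 < pi ^+ 2 / (16 * N%:R ^+ 2) :> R by rewrite divr_gt0 ?mulr_gt0 ?exprn_gt0.
have S := sin_sum_pow2 n; rewrite -/N in S.
apply/andP; split; last first.
  have -> : pi ^+ 2 / 8 = pi ^+ 2 / (16 * N%:R ^+ 2) * sin_sum N :> R.
    by rewrite S; field; rewrite gt_eqF.
  by rewrite E ler_pM2l//; apply: ler_sum => k _; have /andP[] := B k.
have -> : pi ^+ 2 / 8 - pi ^+ 2 / 16 / N%:R = pi ^+ 2 / (16 * N%:R ^+ 2) *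
    (sin_sum N - N%:R) :> R.
  by rewrite S; field; rewrite gt_eqF.
rewrite E ler_pM2l//.
rewrite [X in _ - X](_ : _ = \sum_(k < N) 1); last by rewrite sumr_const card_ord.
rewrite -sumrB; apply: ler_sum => k _; by have /andP[] := B k.
Qed.

Lemma zeta_sum_double N : zeta_sum (N + N) = odd_sum N + zeta_sum N / 4.
Proof.
elim: N => [|N IHN]; first by rewrite /zeta_sum /odd_sum !big_ord0 mul0r addr0.
rewrite /zeta_sum /odd_sum addnS addSn !big_ord_recr/= -/(zeta_sum _) -/(odd_sum _).
rewrite IHN -addnn -/(zeta_sum N).
have h : (N + N).+2%:R = 2 * N.+1%:R :> R.
  by rewrite -[(N + N).+2]addn2 -[N.+1]addn1 !natrD; ring.
have n0 : N.+1%:R != 0 :> R by rewrite pnatr_eq0.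
by rewrite h; move: (N.+1%:R) ((N + N).+1%:R ^- 2) n0 => u w u0; field.
Qed.

(** Separating odd and even terms, the limit satisfies l = pi^2 / 8 + l / 4. The same splitting,
    with monotonicity, gives the upper bound that ensures a limit exists. *)
Lemma cvg_zeta_sum : zeta_sum @ \oo --> (pi ^+ 2 / 6 : R).
Proof.
have nd : nondecreasing_seq zeta_sum.
  apply/nondecreasing_seqP => n; rewrite /zeta_sum big_ord_recr/= lerDl.
  by rewrite invr_ge0 exprn_ge0.
have ndo : nondecreasing_seq odd_sum.
  apply/nondecreasing_seqP => n; rewrite /odd_sum big_ord_recr/= lerDl.
  by rewrite invr_ge0 exprn_ge0.
have ub n : zeta_sum n <= pi ^+ 2 / 6.
  have h1 : zeta_sum n <= zeta_sum (n + n) by apply: nd; rewrite leq_addr.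
  have /andP[_ h2] := odd_sum_pow2 n.
  have h3 : odd_sum n <= odd_sum (2 ^ n) by apply: ndo; exact/ltnW/ltn_expl.
  rewrite zeta_sum_double in h1; lra.
have cz : cvgn zeta_sum.
  by apply: nondecreasing_is_cvgn => //; exists (pi ^+ 2 / 6) => _ [n _ <-].
set l := limn zeta_sum.
suff -> : pi ^+ 2 / 6 = l by [].
have c2 : zeta_sum (2 ^ n)%N @[n --> \oo] --> l.
  apply: (cvg_comp _ _ _ cz).
  apply/cvgnyPge => A; near=> n; apply: leq_trans (ltnW (ltn_expl n (ltnSn 1))).
  by near: n; exact: nbhs_infty_ge.
have c3 : zeta_sum (2 ^ n.+1)%N @[n --> \oo] --> l.
  by move: c2; rewrite -(cvg_shiftS (fun n => zeta_sum (2 ^ n)%N)).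
have co : odd_sum (2 ^ n)%N @[n --> \oo] --> (pi ^+ 2 / 8 : R).
  apply: (@squeeze_cvgr _ _ _ _ (fun n => pi ^+ 2 / 8 - pi ^+ 2 / 16 * (2 ^ n)%:R^-1)
    (fun=> pi ^+ 2 / 8)).
  - by near=> n; exact: odd_sum_pow2.
  - rewrite -[X in _ --> X]subr0; apply: cvgB; first exact: cvg_cst.
    rewrite -[X in _ --> X](mulr0 (pi ^+ 2 / 16)); apply: cvgM; first exact: cvg_cst.
    under eq_cvg do rewrite natrX -exprVn.
    by apply: cvg_expr; rewrite ger0_norm ?invr_ge0// invf_lt1// ltr1n.
  - exact: cvg_cst.
have c4 : zeta_sum (2 ^ n.+1)%N @[n --> \oo] --> pi ^+ 2 / 8 + l / 4.
  under eq_cvg do rewrite expnS mul2n -addnn zeta_sum_double.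
  apply: cvgD => //; apply: cvgM => //; exact: cvg_cst.
have h : (l : R) = pi ^+ 2 / 8 + l / 4 by exact: (cvg_unique _ c3 c4).
by move: (l) h => y h; lra.
Unshelve. all: by end_near. Qed.

End basel.

Local Open Scope ring_scope.

(** * Termwise integration and the variance of the logistic law *)

Section logistic_variance.
Context {R : realType}.
Local Notation leb := (@lebesgue_measure R).

Lemma sqr_expR_bound (x : R) : 0 <= x -> x ^+ 2 / 16 <= expR (x / 2).
Proof.
move=> x0.
have -> : expR (x / 2) = expR (x / 4) ^+ 2 by rewrite -expRM_natr; congr expR; field.
have -> : x ^+ 2 / 16 = (x / 4) ^+ 2 by field.
rewrite lerXn2r ?nnegrE ?expR_ge0 ?divr_ge0//.
by rewrite (le_trans _ (expR_ge1Dx _))// lerDr.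
Qed.

Lemma integral_sqr_expR (c : R) : 0 < c ->
  (\int[leb]_(x in `[0%R, +oo[) (x ^+ 2 * expR (- (c * x)))%:E = (2 / c ^+ 3)%:E)%E.
Proof.
move=> c0; have c0' : c != 0 by rewrite gt_eqF.
(* The primitive from two integrations by parts: it vanishes at infinity and equals - 2 / c^3 at
   0. *)
pose F (x : R) : R := - ((x ^+ 2 / c + 2 * x / c ^+ 2 + 2 / c ^+ 3) * expR (- (c * x))).
have dF (x : R) : is_derive x 1 F (x ^+ 2 * expR (- (c * x))).
  rewrite /F; apply: is_derive_eq; rewrite /GRing.scale/=; field.
  by rewrite c0'.
have cF : continuous F by move=> x; exact/differentiable_continuous/derivable1_diffP.
rewrite (@ge0_continuous_FTC2y _ _ F _ 0).
- rewrite /F !mulr0 oppr0 expR0 -EFinB; congr EFin; field.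
  by rewrite c0'.
- by move=> x _; rewrite mulr_ge0 ?expR_ge0 ?sqr_ge0.
- apply: continuous_subspaceT => x.
  apply: cvgM; first exact: exprn_continuous.
  apply: (@cvg_comp _ _ _ (fun x : R => - (c * x)) expR); last exact: continuous_expR.
  by apply: cvgN; apply: cvgM; [exact: cvg_cst|exact: cvg_id].
- pose K := 16 / c ^+ 3 + 8 / c ^+ 3 + 2 / c ^+ 3.
  apply: (@squeeze_cvgr _ _ _ _ (fun x => - (K * expR (- (c / 2 * x)))) (fun=> 0)); last 2 first.
  + rewrite -oppr0; apply: cvgN; rewrite -[X in _ --> X](mulr0 K).
    apply: cvgM; first exact: cvg_cst.
    apply: (@cvg_comp _ _ _ (fun x => c / 2 * x) (fun y => expR (- y)) _ (pinfty_nbhs R)); last exact: cvgr_expR.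
    by apply: gt0_cvgMry; [rewrite divr_gt0|exact: cvg_id].
  + exact: cvg_cst.
  near=> x; have x0 : 0 <= x by near: x; exact: nbhs_pinfty_ge.
  have cx0 : 0 <= c * x by rewrite mulr_ge0// ltW.
  rewrite /F lerN2 oppr_le0; apply/andP; split; last first.
    by rewrite mulr_ge0 ?expR_ge0// !addr_ge0 ?divr_ge0 ?mulr_ge0 ?exprn_ge0// ltW.
  have -> : expR (- (c * x)) = expR (- (c * x / 2)) * expR (- (c / 2 * x)).
    by rewrite -expRD; congr expR; field.
  rewrite mulrA ler_wpM2r ?expR_ge0//.
  rewrite expRN ler_pdivrMr ?expR_gt0//.
  have e0 : 1 <= expR (c * x / 2) by rewrite -expR0 ler_expR divr_ge0.
  have e1 : c * x / 2 <= expR (c * x / 2) by rewrite (le_trans _ (expR_ge1Dx _))// lerDr.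
  have e2 := sqr_expR_bound cx0.
  move: (expR _) e0 e1 e2 => E e0 e1 e2.
  have -> : x ^+ 2 / c + 2 * x / c ^+ 2 + 2 / c ^+ 3 = ((c * x) ^+ 2 / 16 * 16 + c * x / 2 * 4 + 2) / c ^+ 3.
    by field; rewrite c0'.
  have -> : K * E = (16 * E + 8 * E + 2 * E) / c ^+ 3 by rewrite /K; field; rewrite c0'.
  rewrite ler_pM2r ?invr_gt0 ?exprn_gt0//; lra.
- by move=> x _.
- by apply: cvg_at_right_filter; exact: cF.
- by move=> x _; rewrite derive1E; exact: derive_val.
Unshelve. all: by end_near. Qed.

Lemma sum_arith_geom (u : R) N : u != 1 ->
  \sum_(0 <= k < N) k.+1%:R * u ^+ k.+1 =
  u * (1 - N.+1%:R * u ^+ N + N%:R * u ^+ N.+1) / (1 - u) ^+ 2.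
Proof.
move=> u1; have u1' : 1 - u != 0 by rewrite subr_eq0 eq_sym.
elim: N => [|N IHN].
  by rewrite big_geq// expr0 mulr1 mul0r addr0 subrr mulr0 mul0r.
rewrite big_nat_recr//= IHN !exprS -[N.+2]addn2 -[N.+1]addn1 !natrD.
by field.
Qed.

(* This is 1 / (4 sinh^2 (x / 2)). Its expansion in powers of exp(-x) has
   nonnegative terms, unlike that of logistic_pdf, so it can be integrated
   termwise by monotone convergence. *)
Definition inv_sinh2 (x : R) : R := expR (- x) / (1 - expR (- x)) ^+ 2.

Lemma inv_sinh2_ge0 x : 0 <= inv_sinh2 x.
Proof. by rewrite divr_ge0 ?expR_ge0// sqr_ge0. Qed.

Lemma inv_sinh2_series (x : R) : 0 < x ->
  (\sum_(k <oo) (k.+1%:R * expR (- (k.+1%:R * x)))%:E = (inv_sinh2 x)%:E)%E.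
Proof.
move=> x0; set u := expR (- x).
have u0 : 0 < u by exact: expR_gt0.
have u1 : u < 1 by rewrite -expR0 ltr_expR oppr_lt0.
have ue k : expR (- (k%:R * x)) = u ^+ k by rewrite /u -expRM_natl; congr expR; ring.
apply/cvg_lim => //.
rewrite (_ : (fun n => _) = EFin \o (fun N => \sum_(0 <= k < N) k.+1%:R * u ^+ k.+1)); last first.
  by apply/funext => n /=; rewrite -sumEFin; apply: eq_bigr => k _; rewrite ue.
apply: cvg_EFin; first exact: nearW.
under eq_cvg => N do rewrite /= sum_arith_geom ?lt_eqF//.
have c0 : (expR x * (16 / x ^+ 2)) * N.+1%:R^-1 @[N --> \oo] --> (0 : R).
  rewrite -[X in _ --> X](mulr0 (expR x * (16 / x ^+ 2))); apply: cvgM; first exact: cvg_cst.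
  exact: cvg_harmonic.
(* Both boundary terms of the finite sum vanish at rate 1 / N, because exp y >= y^2 / 16 at y = (N +
   1) x. *)
have b N : N.+1%:R * u ^+ N <= (expR x * (16 / x ^+ 2)) * N.+1%:R^-1.
  have y0 : 0 < N.+1%:R * x by rewrite mulr_gt0.
  have h := sqr_expR_bound (ltW y0).
  have -> : u ^+ N = expR x * expR (- (N.+1%:R * x)).
    by rewrite -ue -expRD -[N.+1]addn1 natrD; congr expR; ring.
  have h2 : expR (- (N.+1%:R * x)) <= 16 / (N.+1%:R * x) ^+ 2.
    rewrite expRN -[leRHS]invf_div lef_pV2 ?posrE ?expR_gt0 ?divr_gt0 ?exprn_gt0//.
    by rewrite (le_trans h)// ler_expR; lra.
  rewrite mulrCA -mulrA ler_pM2l ?expR_gt0//.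
  have n0 : 0 < N.+1%:R :> R by [].
  apply: (le_trans (ler_wpM2l (ltW n0) h2)).
  move: (N.+1%:R) n0 => n n0; rewrite le_eqVlt; apply/orP; left; apply/eqP; field.
  by rewrite !gt_eqF.
have Nu : N.+1%:R * u ^+ N @[N --> \oo] --> (0 : R).
  apply: (squeeze_cvgr _ (cvg_cst 0) c0); near=> N.
  by rewrite b mulr_ge0// exprn_ge0// ltW.
have Nu' : N%:R * u ^+ N.+1 @[N --> \oo] --> (0 : R).
  apply: (squeeze_cvgr _ (cvg_cst 0) c0); near=> N.
  rewrite mulr_ge0 ?exprn_ge0 ?(ltW u0)//= (le_trans _ (b N))//.
  rewrite exprS ler_pM ?ler_nat ?mulr_ge0 ?exprn_ge0 ?(ltW u0)// ler_piMl ?exprn_ge0 ?(ltW u0)//.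
  exact: ltW.
have -> : inv_sinh2 x = u * (1 - 0 + 0) / (1 - u) ^+ 2 by rewrite subr0 addr0 mulr1.
apply: cvgM; last exact: cvg_cst.
apply: cvgM; first exact: cvg_cst.
apply: cvgD => //; apply: cvgB => //; exact: cvg_cst.
Unshelve. all: by end_near. Qed.

Lemma zeta2_eseries (a : R) : 0 <= a ->
  (\sum_(k <oo) (a * k.+1%:R ^- 2)%:E = (a * (pi ^+ 2 / 6))%:E)%E.
Proof.
move=> a0; apply/cvg_lim => //.
rewrite (_ : (fun n => _) = EFin \o (fun N => a * zeta_sum N)); last first.
  by apply/funext => n /=; rewrite sumEFin -mulr_sumr /zeta_sum big_mkord.
apply: cvg_EFin; first exact: nearW.
under eq_cvg => N do rewrite /=.
by apply: cvgM; [exact: cvg_cst|exact: cvg_zeta_sum].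
Qed.

Lemma measurable_expR_scale (c : R) D : measurable D -> measurable_fun D (fun x : R => expR (- (c * x))).
Proof.
move=> mD; apply: measurable_funTS; apply: measurableT_comp => //.
by apply: measurableT_comp => //; exact: measurable_funM.
Qed.

(** The term of index k >= 1 contributes k * 2 / (k c)^3 = 2 / (c^3 k^2), so the total is 2 / c^3
    times the Basel sum. *)
Lemma integral_sqr_inv_sinh2 (c : R) : 0 < c ->
  (\int[leb]_(x in `]0%R, +oo[) (x ^+ 2 * inv_sinh2 (c * x))%:E = (pi ^+ 2 / 3 / c ^+ 3)%:E)%E.
Proof.
move=> c0; have c0' : c != 0 by rewrite gt_eqF.
have mt k : measurable_fun (`]0%R, +oo[%classic : set (measurableTypeR R))
    (fun x : measurableTypeR R => (x ^+ 2 * (k.+1%:R * expR (- (k.+1%:R * c * x))))%:E).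
  apply/measurable_EFinP; apply: measurable_funM; first exact: measurable_funX.
  by apply: measurable_funM => //; exact: measurable_expR_scale.
transitivity (\int[leb]_(x in `]0%R, +oo[)
    (\sum_(k <oo) (x ^+ 2 * (k.+1%:R * expR (- (k.+1%:R * c * x))))%:E))%E.
  apply: eq_integral => x; rewrite inE/= in_itv/= andbT => x0.
  rewrite EFinM -inv_sinh2_series ?mulr_gt0// -nneseriesZl//.
  by apply: eq_eseriesr => k _; rewrite -EFinM mulrA.
rewrite integral_nneseries//; last first.
  move=> k x _; rewrite lee_fin; apply: mulr_ge0; first exact: sqr_ge0.
  by apply: mulr_ge0; rewrite ?ler0n ?expR_ge0.
transitivity (\sum_(k <oo) (2 / c ^+ 3 * k.+1%:R ^- 2)%:E)%E; last first.
  rewrite zeta2_eseries; last by rewrite divr_ge0// exprn_ge0// ltW.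
  by congr EFin; field; rewrite c0'.
apply: eq_eseriesr => k _.
have k0 : 0 < k.+1%:R :> R by [].
rewrite integral_itv_obnd_cbnd; last exact: mt.
transitivity (\int[leb]_(x in `[0%R, +oo[) (k.+1%:R%:E * (x ^+ 2 * expR (- (k.+1%:R * c * x)))%:E))%E.
  by apply: eq_integral => x _; rewrite -EFinM mulrCA.
rewrite ge0_integralZl//.
- rewrite integral_sqr_expR ?mulr_gt0// -EFinM; congr EFin.
  by move: (k.+1%:R) k0 => n n0; field; rewrite c0' gt_eqF.
- apply/measurable_EFinP; apply: measurable_funM; first exact: measurable_funX.
  exact: measurable_expR_scale.
- by move=> x _; rewrite lee_fin mulr_ge0 ?expR_ge0 ?sqr_ge0.
Qed.

(** With u = exp(- x) this is u / (1 - u)^2 - u / (1 + u)^2 = 4 u^2 / (1 - u^2)^2. It exchanges the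
    alternating expansion of the logistic density for a difference of two positive ones. *)
Lemma logistic_pdf_inv_sinh2 (x : R) : 0 < x ->
  inv_sinh2 x = logistic_pdf x + 4 * inv_sinh2 (2 * x).
Proof.
move=> x0; rewrite /inv_sinh2 /logistic_pdf.
have -> : expR (- (2 * x)) = expR (- x) ^+ 2 by rewrite -expRM_natl; congr expR; ring.
have u1 : expR (- x) < 1 by rewrite -expR0 ltr_expR oppr_lt0.
have u0 := expR_gt0 (- x).
move: (expR (- x)) u1 u0 => u u1 u0.
have h1 : 1 - u != 0 by rewrite subr_eq0 gt_eqF.
have h2 : 1 + u != 0 by rewrite gt_eqF// addr_gt0.
have -> : 1 - u ^+ 2 = (1 - u) * (1 + u) by ring.
by field; rewrite h2 h1.
Qed.

(** The value is pi^2 / 3 - 4 * pi^2 / 24, from the scales c = 1 and c = 2. The relation is kept as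
    a sum of nonnegative integrals, since it is also what excludes an infinite logistic integral. *)
Lemma integral_sqr_logistic_half :
  (\int[leb]_(x in `[0%R, +oo[) (x ^+ 2 * logistic_pdf x)%:E = (pi ^+ 2 / 6)%:E)%E.
Proof.
have mf : measurable_fun (`]0%R, +oo[%classic : set (measurableTypeR R))
    (fun x : measurableTypeR R => (x ^+ 2 * logistic_pdf x)%:E).
  apply/measurable_EFinP; apply: measurable_funM; first exact: measurable_funX.
  by apply: measurable_funTS; exact: measurable_logistic_pdf.
have mh : measurable_fun (`]0%R, +oo[%classic : set (measurableTypeR R))
    (fun x : measurableTypeR R => (x ^+ 2 * inv_sinh2 (2 * x))%:E).
  apply/measurable_EFinP; apply: measurable_funM; first exact: measurable_funX.
  apply: open_continuous_measurable_fun => // x; rewrite inE/= in_itv/= andbT => x0.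
  have cE : expR (- (2 * y)) @[y --> x] --> expR (- (2 * x)).
    apply: (@cvg_comp _ _ _ (fun x : R => - (2 * x)) expR); last exact: continuous_expR.
    by apply: cvgN; apply: cvgM; [exact: cvg_cst|exact: cvg_id].
  apply: cvgM => //; apply: cvgV.
    by rewrite sqrf_eq0 subr_eq0 gt_eqF// -expR0 ltr_expR oppr_lt0 mulr_gt0.
  apply: (@cvg_comp _ _ _ (fun x : R => 1 - expR (- (2 * x))) (fun y => y ^+ 2)); last exact: sqr_continuous.
  by apply: cvgB => //; exact: cvg_cst.
rewrite -integral_itv_obnd_cbnd//.
have A := integral_sqr_inv_sinh2 ltr01; rewrite expr1n divr1 in A.
have B := @integral_sqr_inv_sinh2 2 (ltr0Sn _ 1).
have : (\int[leb]_(x in `]0%R, +oo[) (x ^+ 2 * inv_sinh2 (1 * x))%:E =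
  \int[leb]_(x in `]0%R, +oo[) (x ^+ 2 * logistic_pdf x)%:E +
   4%:E * \int[leb]_(x in `]0%R, +oo[) (x ^+ 2 * inv_sinh2 (2 * x))%:E)%E.
  rewrite -ge0_integralZl//; last first.
    by move=> x _; rewrite lee_fin mulr_ge0 ?inv_sinh2_ge0 ?sqr_ge0.
  rewrite -ge0_integralD//; first last.
  - exact: measurable_funeM.
  - by move=> x _; rewrite mule_ge0// lee_fin mulr_ge0 ?inv_sinh2_ge0 ?sqr_ge0.
  - by move=> x _; rewrite lee_fin mulr_ge0 ?logistic_pdf_ge0 ?sqr_ge0.
  apply: eq_integral => x; rewrite inE/= in_itv/= andbT => x0.
  by rewrite mul1r (logistic_pdf_inv_sinh2 x0) -EFinM -EFinD; congr EFin; ring.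
rewrite A B.
case: (\int[leb]_(x in _) _)%E => [r| |]//= [] h; congr EFin; lra.
Qed.

Lemma logistic_moment2 (m : probability (measurableTypeR R) R) :
  has_density m logistic_pdf -> moment m 2 = pi ^+ 2 / 3.
Proof.
move=> mE; rewrite /moment /Rintegral.
rewrite (ge0_integral_has_density measurable_logistic_pdf logistic_pdf_ge0 mE); first last.
- by move=> x; rewrite lee_fin sqr_ge0.
- by apply/measurable_EFinP; exact: measurable_funX.
under eq_integral do rewrite -EFinM.
rewrite (@ge0_symfun_integralT R (fun x => x ^+ 2 * logistic_pdf x)).
- by rewrite -set_itvcy integral_sqr_logistic_half -EFinM/=; field.
- by move=> x; rewrite mulr_ge0 ?logistic_pdf_ge0 ?sqr_ge0.
- move=> x; apply: cvgM; first exact: exprn_continuous.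
  exact: continuous_logistic_pdf.
- by move=> x /=; rewrite sqrrN logistic_pdfN.
Qed.

End logistic_variance.

(** * Sums of logistic variables against the Gaussian *)

Local Open Scope ring_scope.

Section berry_esseen.
Context {R : realType}.
Local Notation leb := (@lebesgue_measure R).
Local Notation gauss := (@std_gauss R).

Definition sigma : R := pi / Num.sqrt 3.

Lemma sigma_sqr : sigma ^+ 2 = pi ^+ 2 / 3.
Proof. by rewrite /sigma expr_div_n sqr_sqrtr. Qed.

Lemma sigma_gt0 : 0 < sigma.
Proof. by rewrite divr_gt0 ?pi_gt0// sqrtr_gt0. Qed.

(** The fourth moment is written with the density, not with the law [m], so that the constant is
    fixed before any probability space or law is introduced. *)
Definition swap_cst : R := (1 + taylor_cst / 2) *
  (\int[leb]_y (y ^+ 4 * logistic_pdf y) + sigma ^+ 4 * moment gauss 4).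

Lemma swap_cst_ge0 : 0 <= swap_cst.
Proof.
have e4 (y : R) : 0 <= y ^+ 4 by rewrite (exprM _ 2 2) sqr_ge0.
rewrite /swap_cst mulr_ge0//.
  by rewrite addr_ge0// divr_ge0// /taylor_cst !mulr_ge0 ?exprn_ge0// expR_ge0.
rewrite addr_ge0//.
  by apply: Rintegral_ge0 => y _; rewrite mulr_ge0// logistic_pdf_ge0.
by rewrite mulr_ge0//; apply: Rintegral_ge0.
Qed.

(** The summand 4 covers s <= 1, where the trivial bound B is used and (s + 1)^2 <= 4; the summand 4
    * [swap_cst] covers s > 1, where (s + 1)^2 <= 4 s^2. *)
Definition berry_esseen_cst : R := 4 + 4 * swap_cst.

Lemma berry_esseen_cst_ge0 : 0 <= berry_esseen_cst.
Proof. by rewrite addr_ge0// mulr_ge0// swap_cst_ge0. Qed.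

Variable m : probability (measurableTypeR R) R.
Hypothesis mE : has_density m logistic_pdf.

Local Notation L := (avg m 1).
Local Notation T := (avg gauss).

Definition swap (g : R -> R) (x : R) : R := L g x - T sigma g x.

Lemma logistic_moment4 : moment m 4 = \int[leb]_y (y ^+ 4 * logistic_pdf y).
Proof.
have e4 (y : R) : 0 <= y ^+ 4 by rewrite (exprM _ 2 2) sqr_ge0.
rewrite /moment /Rintegral.
rewrite (ge0_integral_has_density measurable_logistic_pdf logistic_pdf_ge0 mE)//.
by apply/measurable_EFinP; exact: measurable_funX.
Qed.

Lemma swap_smooth (s B : R) (g : R -> R) (x : R) : 0 <= s -> nnbounded B g ->
  `|swap (T (Num.sqrt s) g) x| <= berry_esseen_cst * B / (s + 1) ^+ 2.
Proof.
move=> s0 gB; have B0 : 0 <= B by have /andP[] := gB.2 0; exact: le_trans.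
have c0 := swap_cst_ge0.
have [s1|s1] := leP s 1.
  have TB := avg_nnbounded gauss (Num.sqrt s) gB.
  have /andP[a0 aB] := avg_bound m 1 x TB; have /andP[b0 bB] := avg_bound gauss sigma x TB.
  clear TB; apply: (@le_trans _ _ B); first by rewrite ler_norml /swap; apply/andP; split; lra.
  rewrite ler_pdivlMr ?exprn_gt0 ?ltr_wpDl// /berry_esseen_cst.
  have : (s + 1) ^+ 2 <= 4 by nra.
  move=> h; rewrite mulrC ler_wpM2r//; lra.
have rs : 0 < Num.sqrt s by rewrite sqrtr_gt0 (lt_trans _ s1).
have m4 := logistic_moment4_integrable mE; have g4 := @gauss_moment4_integrable R.
have := avg_swap x rs gB (logistic_symmetric mE) (@gauss_symmetric R) (c := 1) (e := sigma)
  (integrable_moment2 m4) m4 (integrable_moment2 g4) g4.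
rewrite (logistic_moment2 mE) gauss_moment2 !expr1n !mul1r mulr1 sigma_sqr => /(_ erefl).
rewrite logistic_moment4 -/swap_cst -/(swap _ _).
have -> : Num.sqrt s ^+ 4 = s ^+ 2 by rewrite (exprM _ 2 2) sqr_sqrtr.
move=> h; apply: (le_trans h).
rewrite ler_pdivrMr ?exprn_gt0 ?(lt_trans _ s1)// mulrAC ler_pdivlMr ?exprn_gt0 ?ltr_wpDl//.
have h2 : (s + 1) ^+ 2 <= 4 * s ^+ 2 by nra.
have h3 : B * swap_cst * (s + 1) ^+ 2 <= B * swap_cst * (4 * s ^+ 2).
  by rewrite ler_wpM2l// mulr_ge0.
have h4 : 0 <= B * s ^+ 2 by rewrite mulr_ge0 ?sqr_ge0.
by rewrite /berry_esseen_cst; lra.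
Qed.

Lemma iter_avg_nnbounded j (B : R) (g : R -> R) : nnbounded B g -> nnbounded B (iter j L g).
Proof. by move=> gB; elim: j => [//|j IHj]; exact: avg_nnbounded. Qed.

Lemma avg_lin n (r a B C : R) (g k : R -> R) x : 0 <= a -> nnbounded B g -> nnbounded C k ->
  avg n r (fun y => a * g y + k y) x = a * avg n r g x + avg n r k x.
Proof.
by move=> a0 gB kC; rewrite (avgD n r x (nnboundedZ a0 gB) kC) (avgZ n r a x gB).
Qed.

Lemma iter_avg_lin j (a B C : R) (g k : R -> R) x : 0 <= a -> nnbounded B g -> nnbounded C k ->
  iter j L (fun y => a * g y + k y) x = a * iter j L g x + iter j L k x.
Proof.
move=> a0 gB kC; elim: j x => [//|j IHj] x /=.
by rewrite (eq_avg m 1 x IHj) (avg_lin _ _ _ a0 (iter_avg_nnbounded j gB) (iter_avg_nnbounded j kC)).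
Qed.

Lemma swap_lin (a B C : R) (g k : R -> R) x : 0 <= a -> nnbounded B g -> nnbounded C k ->
  swap (fun y => a * g y + k y) x = a * swap g x + swap k x.
Proof. by move=> a0 gB kC; rewrite /swap !(avg_lin _ _ _ a0 gB kC); ring. Qed.

Lemma iter_avgC n r j (B : R) (g : R -> R) x : nnbounded B g ->
  iter j L (avg n r g) x = avg n r (iter j L g) x.
Proof.
move=> gB; elim: j x => [//|j IHj] x /=.
by rewrite (eq_avg m 1 x IHj) (avgC m n 1 r x (iter_avg_nnbounded j gB)).
Qed.

Definition remainder (g : R -> R) (x : R) : R := L g x - 8^-1 * T 1 g x.

(** The lower bound is the Gaussian minorant. The upper bound is the same inequality applied to
    [B - g], because the operator sends the constant B to 7/8 B. *)
Lemma remainder_nnbounded (B : R) (g : R -> R) : nnbounded B g ->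
  nnbounded (7 / 8 * B) (remainder g).
Proof.
move=> gB; have B0 : 0 <= B by have /andP[] := gB.2 0; exact: le_trans.
split => [|x].
  apply: measurable_funB; first exact: (avg_nnbounded m 1 gB).1.
  by apply: measurable_funM => //; exact: (avg_nnbounded gauss 1 gB).1.
rewrite subr_ge0 (avg_logistic_ge_gauss mE x gB)/=.
have cB : nnbounded B (fun y => B - g y).
  split => [|y]; first by apply: measurable_funB => //; exact: gB.1.
  by have /andP[? ?] := gB.2 y; rewrite subr_ge0 lerBlDr lerDl; apply/andP.
have bB : nnbounded B (fun _ : measurableTypeR R => B).
  by split => // y; rewrite B0 lexx.
have E n : avg n 1 (fun y => B - g y) x = B - avg n 1 g x.
  have : avg n 1 (fun y => (B - g y) + g y) x = B.
    rewrite /avg; under eq_Rintegral do rewrite subrK.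
    by rewrite Rintegral_cst//= probability_setT mulr1.
  by rewrite (avgD n 1 x cB gB) => h; rewrite -[X in X - _]h addrK.
have := avg_logistic_ge_gauss mE x cB; rewrite !E /remainder.
lra.
Qed.

(* (s + 1 + j / 32) ^- 2 is a supersolution of the recursion in j coming from
   L = T_1 / 8 + remainder *)
Lemma supersolution (v : R) : 1 <= v ->
  8^-1 / (v + 1) ^+ 2 + 7 / 8 / v ^+ 2 <= (v + 32^-1) ^- 2.
Proof.
move=> v1; have v0 : 0 < v by exact: lt_le_trans v1.
have d0 : 0 < v + 32^-1 by rewrite addr_gt0.
have e0 : 0 < v + 1 by rewrite addr_gt0.
rewrite -subr_ge0.
have -> : (v + 32^-1) ^- 2 - (8^-1 / (v + 1) ^+ 2 + 7 / 8 / v ^+ 2) =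
  (8 * v ^+ 2 * (v + 1) ^+ 2 - (v ^+ 2 + 7 * (v + 1) ^+ 2) * (v + 32^-1) ^+ 2)
   / (8 * v ^+ 2 * (v + 1) ^+ 2 * (v + 32^-1) ^+ 2).
  have f0 : 32 * v + 1 != 0 by rewrite gt_eqF// addr_gt0// mulr_gt0.
  field.
  by rewrite [v * 32]mulrC f0 !gt_eqF.
rewrite divr_ge0//; last by do ![exact: sqr_ge0|exact: ler0n|apply: mulr_ge0].
(* In powers of w = v - 1 the numerator has nonnegative coefficients. The tight case is v = 1, where
   the left-hand side is 1/32 + 7/8: the shift 1/32 is admissible there, while 1/16 would not be. *)
have [w w0 ->] : exists2 w, 0 <= w & v = w + 1 by exists (v - 1); [rewrite subr_ge0|rewrite subrK].
have w2 : 0 <= w ^+ 2 by exact: sqr_ge0.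
have w3 : 0 <= w ^+ 3 by rewrite exprn_ge0.
have w4 : 0 <= w ^+ 4 by rewrite exprn_ge0.
lra.
Qed.

(** The induction has to vary [s], [B] and [g] together: spending one factor [L] either raises s by
    1 or keeps s and replaces [g] by its remainder, with [B] reduced to 7/8 B. *)
Lemma swap_iter j (s B : R) (g : R -> R) (x : R) : 0 <= s -> nnbounded B g ->
  `|swap (iter j L (T (Num.sqrt s) g)) x| <= berry_esseen_cst * B / (s + 1 + j%:R / 32) ^+ 2.
Proof.
elim: j s B g => [|j IHj] s B g s0 gB; first by rewrite mul0r addr0; exact: swap_smooth.
have K0 := berry_esseen_cst_ge0.
have B0 : 0 <= B by have /andP[] := gB.2 0; exact: le_trans.
have rB := remainder_nnbounded gB.
have s10 : 0 <= s + 1 by rewrite addr_ge0.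
have E : L (T (Num.sqrt s) g) = fun y => 8^-1 * T (Num.sqrt (s + 1)) g y + T (Num.sqrt s) (remainder g) y.
  apply/funext => y; rewrite (avgC _ _ _ _ _ gB).
  rewrite (@eq_avg _ _ _ _ (fun y => 8^-1 * T 1 g y + remainder g y)); last first.
    by move=> z; rewrite /remainder subrKC.
  rewrite (avg_lin _ _ _ _ (avg_nnbounded _ _ gB) rB) ?invr_ge0//.
  by rewrite (avg_normal_semigroup y (sqrtr_ge0 s) ler01 gB) (sqr_sqrtr s0) expr1n.
rewrite iterSr E.
have TB := avg_nnbounded gauss (Num.sqrt (s + 1)) gB.
have TrB := avg_nnbounded gauss (Num.sqrt s) rB.
have -> : iter j L (fun y => 8^-1 * T (Num.sqrt (s + 1)) g y + T (Num.sqrt s) (remainder g) y) =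
   fun y => 8^-1 * iter j L (T (Num.sqrt (s + 1)) g) y + iter j L (T (Num.sqrt s) (remainder g)) y.
  by apply/funext => y; rewrite (iter_avg_lin _ _ _ TB TrB).
rewrite (swap_lin _ _ (iter_avg_nnbounded j TB) (iter_avg_nnbounded j TrB)) ?invr_ge0//.
have h1 := IHj _ _ _ s10 gB; have h2 := IHj _ _ _ s0 rB.
rewrite (le_trans (ler_normD _ _))// normrM (@ger0_norm _ 8^-1)//.
pose v : R := s + 1 + j%:R / 32.
have v1 : 1 <= v by rewrite /v -addrA addrCA lerDl addr_ge0// divr_ge0.
have -> : s + 1 + j.+1%:R / 32 = v + 32^-1 by rewrite /v -[j.+1]addn1 natrD; field.
have vE : s + 1 + 1 + j%:R / 32 = v + 1 by rewrite /v; ring.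
rewrite vE in h1; rewrite -/v in h2.
have KB : 0 <= berry_esseen_cst * B by rewrite mulr_ge0.
apply: le_trans (ler_wpM2l KB (supersolution v1)).
apply: (le_trans (lerD (ler_wpM2l _ h1) h2)); first by rewrite invr_ge0.
rewrite le_eqVlt; apply/orP; left; apply/eqP; field.
have v0 : 0 < v by exact: lt_le_trans v1.
by rewrite (gt_eqF v0) (gt_eqF (addr_gt0 v0 ltr01)).
Qed.

Lemma sigma_sqr_ge1 : 1 <= sigma ^+ 2.
Proof. by rewrite sigma_sqr; have := pi_ge2 R; nra. Qed.

Lemma logistic_sum_gauss p (B : R) (g : R -> R) (x : R) : (0 < p)%N -> nnbounded B g ->
  `|iter p L g x - T (sigma * Num.sqrt p%:R) g x| <= 32 ^+ 2 * berry_esseen_cst * B / p%:R.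
Proof.
move=> p0 gB; have K0 := berry_esseen_cst_ge0.
have B0 : 0 <= B by have /andP[] := gB.2 0; exact: le_trans.
(* [H j] has j logistic and p - j Gaussian summands; at j = p the Gaussian scale is 0 and its
   average is the identity. *)
pose H j := iter j L (T (sigma * Num.sqrt (p - j)%:R) g) x.
have -> : iter p L g x - T (sigma * Num.sqrt p%:R) g x = \sum_(0 <= j < p) (H j.+1 - H j).
  rewrite telescope_sumr// /H subn0 subnn sqrtr0 mulr0; congr (_ - _).
  by congr (iter p L _ x); apply/funext => y; rewrite avg0.
have p0' : 0 < p%:R :> R by rewrite ltr0n.
have b j : (j < p)%N -> `|H j.+1 - H j| <= berry_esseen_cst * B / (p%:R / 32) ^+ 2.
  move=> jp; pose s : R := sigma ^+ 2 * (p - j.+1)%:R.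
  have s0 : 0 <= s by rewrite mulr_ge0 ?sqr_ge0.
  have q0 := ltW sigma_gt0.
  have -> : H j.+1 - H j = swap (iter j L (T (Num.sqrt s) g)) x.
    have TB := avg_nnbounded gauss (Num.sqrt s) gB.
    have es : Num.sqrt s = sigma * Num.sqrt (p - j.+1)%:R.
      by rewrite /s sqrtrM ?sqr_ge0// sqrtr_sqr ger0_norm.
    have -> : H j.+1 = L (iter j L (T (Num.sqrt s) g)) x by rewrite es.
    have ss : sigma ^+ 2 + s = sigma ^+ 2 * (p - j)%:R.
      by rewrite -(subnSK jp) /s -[(p - j.+1).+1]addn1 natrD; ring.
    have ET : T (sigma * Num.sqrt (p - j)%:R) g = T sigma (T (Num.sqrt s) g).
      apply/funext => y; rewrite (avg_normal_semigroup y q0 (sqrtr_ge0 s) gB).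
      by rewrite (sqr_sqrtr s0) ss sqrtrM ?sqr_ge0// sqrtr_sqr ger0_norm.
    have -> : H j = T sigma (iter j L (T (Num.sqrt s) g)) x.
      by rewrite /H ET (iter_avgC _ _ _ _ TB).
    by [].
  apply: (le_trans (swap_iter j x s0 gB)).
  rewrite ler_wpM2l ?mulr_ge0//.
  (* Since sigma^2 >= 1, s + 1 >= p - j >= (p - j) / 32. Every term is thus at most a constant times
     32^2 / p^2, uniformly in j, and p of them leave 32^2 / p. *)
  have h : p%:R / 32 <= s + 1 + j%:R / 32.
    have h1 : (p - j.+1)%:R <= s by rewrite ler_peMl// sigma_sqr_ge1.
    have h2 : (p - j.+1)%:R = p%:R - (j%:R + 1) :> R by rewrite natrB// -[j.+1]addn1 natrD.
    have h3 : j%:R + 1 <= p%:R :> R by rewrite natr1 ler_nat.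
    have h4 : 0 <= j%:R :> R by [].
    lra.
  have h0 : 0 < p%:R / 32 :> R by rewrite divr_gt0.
  rewrite lef_pV2 ?posrE ?exprn_gt0 ?(lt_le_trans h0)//.
  by rewrite lerXn2r ?nnegrE ?(le_trans (ltW h0)) ?(ltW h0).
rewrite (le_trans (ler_norm_sum _ _ _))//.
rewrite big_mkord (le_trans (ler_sum _ (fun j _ => b _ (ltn_ord j))))//.
rewrite sumr_const card_ord -mulr_natl le_eqVlt; apply/orP; left; apply/eqP; field.
by rewrite gt_eqF.
Qed.

End berry_esseen.

(** * Independence of blocks and convolution *)

Local Open Scope ring_scope.

Section independence.
Context d (T : measurableType d) (R : realType) (Pr : probability T R).
Local Open Scope ereal_scope.

(** For fixed [E] the events independent of it form a Dynkin system, so independence passes from a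
    pi-system to the sigma-algebra it generates. *)
Lemma indep_sigma_l (G : set (set T)) (E : set T) :
  measurable E -> setI_closed G -> G `<=` measurable ->
  (forall A, G A -> Pr (A `&` E) = Pr A * Pr E) ->
  forall A, <<s G >> A -> Pr (A `&` E) = Pr A * Pr E.
Proof.
move=> mE GI Gm GE.
have sub A : <<s G >> A -> measurable A.
  by apply: smallest_sub => //; exact: sigma_algebra_measurable.
have fE : Pr E \is a fin_num by rewrite fin_num_measure.
have HC (S : set T) : measurable S -> Pr (S `&` E) = Pr S * Pr E ->
    Pr (~` S `&` E) = Pr (~` S) * Pr E.
  move=> mS SE; rewrite probability_setC// setIC -setDE measureD//; last first.
    by rewrite (le_lt_trans (probability_le1 _ _))// ltry.
  rewrite [X in _ - X](_ : _ = Pr S * Pr E); last by rewrite setIC.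
  by rewrite muleBl ?mul1e// fin_num_adde_defl// fin_num_measure.
have HU (F : (set T)^nat) : (forall n, measurable (F n)) -> trivIset setT F ->
    (forall n, Pr (F n `&` E) = Pr (F n) * Pr E) ->
    Pr (\bigcup_n F n `&` E) = Pr (\bigcup_n F n) * Pr E.
  move=> mF tF FE; rewrite setI_bigcupl !measure_bigcup//=; last 2 first.
  + by move=> n _; exact: measurableI.
  + exact: trivIset_setIr.
  rewrite muleC -(fineK fE) -nneseriesZl//.
  by apply: eq_eseriesr => n _; rewrite fineK// muleC; exact: FE.
apply: (@dynkin_induction _ (g_sigma_algebraType G) G) => //.
- by rewrite setTI probability_setT mul1e.
- by move=> S mS SE; exact: (HC S (sub _ mS) SE).
- by move=> F mF tF FE; exact: (HU F (fun n => sub _ (mF n)) tF FE).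
Qed.

Lemma indep_sigma (G H : set (set T)) :
  setI_closed G -> setI_closed H -> G `<=` measurable -> H `<=` measurable ->
  (forall A B, G A -> H B -> Pr (A `&` B) = Pr A * Pr B) ->
  forall A B, <<s G >> A -> <<s H >> B -> Pr (A `&` B) = Pr A * Pr B.
Proof.
move=> GI HI Gm Hm GH A B GA HB.
have mA : measurable A.
  by move: GA; apply: smallest_sub => //; exact: sigma_algebra_measurable.
rewrite setIC muleC; apply: (indep_sigma_l mA HI Hm) HB => {}B HB.
rewrite setIC muleC; apply: (indep_sigma_l (Hm _ HB) GI Gm) GA => {mA}A GA.
exact: GH.
Qed.

(** Finite cylinder events: a pi-system generating the sigma-algebra of the variables indexed by
    [K], on which mutual independence can be read off directly. *)
Definition rectangles (I : eqType) (V : I -> T -> R) (K : set I) : set (set T) :=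
  [set A | exists J : seq I, exists B : I -> set R,
    [/\ uniq J, [set` J] `<=` K, forall i, measurable (B i) &
     A = \bigcap_(i in [set` J]) (V i @^-1` B i)]].

Variables (I : eqType) (V : I -> T -> R) (D : set I).
Hypothesis mV : forall i, D i -> measurable_fun setT (V i).
Hypothesis indV : mutually_independent Pr D V.

Lemma rectangles_measurable K : K `<=` D -> rectangles V K `<=` measurable.
Proof.
move=> KD _ [J [B [uJ JK mB ->]]].
apply: fin_bigcap_measurable => [|i iJ]; first exact: finite_seq.
by rewrite -[X in measurable X]setTI; apply: mV => //; exact/KD/JK.
Qed.

Lemma bigcap_restrict (J J' : seq I) (B : I -> set R) : {subset J <= J'} ->
  \bigcap_(i in [set` J]) (V i @^-1` B i) =
  \bigcap_(i in [set` J']) (V i @^-1` (if i \in J then B i else setT)).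
Proof.
move=> JJ'; apply/seteqP; split => t /= H i iJ.
  by case: ifPn => // iJ1; exact: H.
by have := H i (JJ' _ iJ); rewrite /= (iJ : i \in J).
Qed.

Lemma rectangles_setI K : setI_closed (rectangles V K).
Proof.
move=> _ _ [J [B [uJ JK mB ->]]] [J' [B' [uJ' JK' mB' ->]]].
pose J2 := undup (J ++ J').
pose B2 i := (if i \in J then B i else setT) `&` (if i \in J' then B' i else setT).
exists J2, B2; split.
- exact: undup_uniq.
- by move=> i; rewrite /= /J2 mem_undup mem_cat => /orP[/JK|/JK'].
- by move=> i; apply: measurableI; case: ifP.
- rewrite (@bigcap_restrict J J2) ?(@bigcap_restrict J' J2); last 2 first.
  + by move=> i iJ; rewrite mem_undup mem_cat iJ orbT.
  + by move=> i iJ; rewrite mem_undup mem_cat iJ.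
  by rewrite -bigcapI.
Qed.

Lemma rectangles_indep K K' : K `<=` D -> K' `<=` D -> K `&` K' = set0 ->
  forall A B, rectangles V K A -> rectangles V K' B -> Pr (A `&` B) = Pr A * Pr B.
Proof.
move=> KD KD' KK' _ _ [J [B [uJ JK mB ->]]] [J' [B' [uJ' JK' mB' ->]]].
have disj i : i \in J -> i \in J' -> False.
  move=> iJ iJ'; suff : (K `&` K') i by rewrite KK'.
  by split; [exact: JK|exact: JK'].
pose B2 i := if i \in J then B i else B' i.
have uJJ : uniq (J ++ J').
  rewrite cat_uniq uJ uJ' andbT/=; apply/hasPn => i iJ'.
  by apply/negP => iJ; exact: (disj i).
have E : \bigcap_(i in [set` J]) (V i @^-1` B i) `&` \bigcap_(i in [set` J']) (V i @^-1` B' i)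
   = \bigcap_(i in [set` J ++ J']) (V i @^-1` B2 i).
  apply/seteqP; split => t /=.
    move=> [H H'] i; rewrite /= /B2 mem_cat; case: ifPn => [iJ _|_ /= iJ']; [exact: H|exact: H'].
  move=> H; split => i iJ; have := H i; rewrite /= /B2 mem_cat.
    by rewrite (iJ : i \in J) => /(_ isT).
  rewrite (iJ : i \in J') orbT; case: ifPn => [iJ1|_ /(_ isT)//].
  by case: (disj i).
have JJD : [set` J ++ J'] `<=` D.
  by move=> i; rewrite /= mem_cat => /orP[/JK/KD|/JK'/KD'].
have mB2 i : measurable (B2 i) by rewrite /B2; case: ifP.
rewrite E (indV uJJ JJD mB2) (indV uJ (subset_trans JK KD) mB).
rewrite (indV uJ' (subset_trans JK' KD') mB').
rewrite big_cat/=; congr (_ * _).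
  by apply: eq_big_seq => i iJ; rewrite /B2 iJ.
apply: eq_big_seq => i iJ'; rewrite /B2; case: ifPn => // iJ.
by case: (disj i).
Qed.

(** The sample space with the sigma-algebra generated by the variables indexed by [K]. Measurability
    from this type expresses that a function depends on those variables only, which also covers sums
    of random length. *)
Definition sigma_of (K : set I) := g_sigma_algebraType (rectangles V K).

Lemma measurable_sigma_of K i : K i ->
  measurable_fun setT (V i : sigma_of K -> R).
Proof.
move=> Ki _ B mB; rewrite setTI; apply: sub_gen_smallest.
exists [:: i], (fun=> B); split => //.
- by move=> j /=; rewrite inE => /eqP ->.
- by apply/seteqP; split => [t Bt j /=|t H]; [rewrite inE => /eqP ->|apply: H; rewrite /= inE].
Qed.

Lemma sigma_of_indep K K' (U W : T -> R) A B : K `<=` D -> K' `<=` D -> K `&` K' = set0 ->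
  measurable_fun setT (U : sigma_of K -> R) -> measurable_fun setT (W : sigma_of K' -> R) ->
  measurable A -> measurable B ->
  Pr (U @^-1` A `&` W @^-1` B) = Pr (U @^-1` A) * Pr (W @^-1` B).
Proof.
move=> KD KD' KK' mU mW mA mB.
apply: (indep_sigma (@rectangles_setI K) (@rectangles_setI K')
  (rectangles_measurable KD) (rectangles_measurable KD') (rectangles_indep KD KD' KK')).
  by have := mU measurableT _ mA; rewrite setTI.
by have := mW measurableT _ mB; rewrite setTI.
Qed.

End independence.

Local Open Scope ring_scope.

(** * Distribution functions of sums of independent variables *)

Section convolution.
Context d (T : measurableType d) (R : realType) (Pr : probability T R).
Implicit Types U W : T -> R.

Definition distr_fun U (u : R) : R := fine (Pr [set t | U t <= u]).

Lemma measurable_le U u : measurable_fun setT U -> measurable [set t | U t <= u].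
Proof.
move=> mU; have := mU measurableT `]-oo, u]%classic (measurable_itv _).
by rewrite setTI set_itvNyc.
Qed.

Lemma distr_funE U u : measurable_fun setT U -> (distr_fun U u)%:E = Pr [set t | U t <= u].
Proof. by move=> mU; rewrite fineK// fin_num_measure//; exact: measurable_le. Qed.

Lemma distr_fun_nnbounded U : measurable_fun setT U -> nnbounded 1 (distr_fun U).
Proof.
move=> mU; split => [|u]; last first.
  by rewrite -!lee_fin distr_funE// measure_ge0/= probability_le1//; exact: measurable_le.
apply: nondecreasing_measurable => // u v uv.
rewrite /distr_fun fine_le ?fin_num_measure//; [exact: measurable_le..|].
apply: le_measure; rewrite ?inE; [exact: measurable_le..|].
by move=> t /= /le_trans; exact.
Qed.

(** By uniqueness of product measures the pair (W, U) has the product law. [W] comes first so that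
    the outer integral runs over [n]; the section at y of the event is U <= x - r y. *)
Lemma distr_fun_addM U W (n : probability (measurableTypeR R) R) (r x : R) :
  measurable_fun setT U -> measurable_fun setT W ->
  (forall A B, measurable A -> measurable B ->
     Pr (U @^-1` A `&` W @^-1` B) = (Pr (U @^-1` A) * Pr (W @^-1` B))%E) ->
  (forall B, measurable B -> Pr (W @^-1` B) = n B) ->
  distr_fun (fun t => U t + r * W t) x = avg n r (distr_fun U) x.
Proof.
move=> mU mW UW Wn; apply: EFin_inj; rewrite (avgE n r x (distr_fun_nnbounded mU)).
rewrite distr_funE; last by apply: measurable_funD => //; exact: measurable_funM.
pose X : T -> measurableTypeR R := U.
have mX : measurable_fun setT X by [].
pose mu : probability (measurableTypeR R) R := distribution Pr (mfun_Sub (mem_set mX)).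
pose VU t : measurableTypeR R * measurableTypeR R := (W t, U t).
have mVU : measurable_fun setT VU by exact: measurable_fun_pair.
pose q : {measure set (measurableTypeR R * measurableTypeR R) -> \bar R} := pushforward Pr VU.
pose S := [set z : measurableTypeR R * measurableTypeR R | z.2 + r * z.1 <= x].
have mS : measurable S.
  have mf : measurable_fun setT (fun z : measurableTypeR R * measurableTypeR R => z.2 + r * z.1).
    by apply: measurable_funD => //; exact: measurable_funM.
  have := mf measurableT `]-oo, x]%classic (measurable_itv _).
  by rewrite setTI set_itvNyc.
have qE : forall A B, measurable A -> measurable B -> q mVU (A `*` B) = (n A * mu B)%E.
  move=> A B mA mB; rewrite -Wn// muleC.
  exact: etrans (congr1 Pr (setIC _ _)) (UW B A mB mA).
have := product_measure_unique qE mS.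
rewrite /product_measure1 => h; apply: etrans (etrans (esym h) _); first by [].
apply: eq_integral => y _ /=; rewrite distr_funE//.
congr (Pr _); apply/seteqP; split => t; by rewrite /= /xsection/= inE /S/= lerBrDr.
Qed.

End convolution.

(** * Replacing one block at a time *)

Local Open Scope ring_scope.

Lemma measurable_nat_level d (T : measurableType d) (R : realType) (p : T -> nat) j :
  measurable_fun setT (fun t => (p t)%:R : R) -> measurable [set t | p t = j].
Proof.
move=> mp; have := mp measurableT [set j%:R] (measurable_set1 _); rewrite setTI.
congr measurable; apply/seteqP; split => t /=; last by move=> ->.
by move=> /eqP; rewrite eqr_nat => /eqP.
Qed.

Lemma measurable_random_index d (T : measurableType d) (R : realType) (p : T -> nat)
    (F : nat -> T -> R) :
  (forall j, measurable [set t | p t = j]) -> (forall j, measurable_fun setT (F j)) ->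
  measurable_fun setT (fun t => F (p t) t).
Proof.
move=> mp mF _ B mB; rewrite setTI.
have -> : (fun t => F (p t) t) @^-1` B = \bigcup_j ([set t | p t = j] `&` F j @^-1` B).
  by apply/seteqP; split => [t Bt|t [j _ /= [<-]]//]; exists (p t).
apply: bigcupT_measurable => j; apply: measurableI => //.
by rewrite -[X in measurable X]setTI; exact: mF.
Qed.

Lemma measurable_sum1 d (T : measurableType d) (R : realType) (X : nat -> T -> R) j :
  (forall k, (1 <= k)%N -> measurable_fun setT (X k)) ->
  measurable_fun setT (fun t => \sum_(1 <= k < j.+1) X k t).
Proof.
move=> mX; under eq_fun do rewrite big_add1.
by apply: measurable_sum => k; exact: mX.
Qed.

Section random_index_swap.
Context d (T : measurableType d) (R : realType) (Pr : probability T R).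
Variables (U : T -> R) (X : nat -> T -> R) (p : T -> nat) (Z : T -> R).
Variable m : probability (measurableTypeR R) R.
Hypothesis mE : has_density m logistic_pdf.
Hypothesis mU : measurable_fun setT U.
Hypothesis mX : forall k, (1 <= k)%N -> measurable_fun setT (X k).
Hypothesis mp : forall j, measurable [set t | p t = j].
Hypothesis mZ : measurable_fun setT Z.
Hypothesis XE : forall k, (1 <= k)%N -> forall B, measurable B -> Pr (X k @^-1` B) = m B.
Hypothesis ZE : forall B, measurable B -> Pr (Z @^-1` B) = std_gauss B.

Let S j t : R := U t + \sum_(1 <= k < j.+1) X k t.

Hypothesis indSX : forall j A B, measurable A -> measurable B ->
  Pr (S j @^-1` A `&` X j.+1 @^-1` B) = (Pr (S j @^-1` A) * Pr (X j.+1 @^-1` B))%E.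
Hypothesis indUZ : forall A B, measurable A -> measurable B ->
  Pr (U @^-1` A `&` Z @^-1` B) = (Pr (U @^-1` A) * Pr (Z @^-1` B))%E.
Hypothesis indpS : forall j i B, measurable B ->
  Pr ([set t | p t = i] `&` S j @^-1` B) = (Pr [set t | p t = i] * Pr (S j @^-1` B))%E.
Hypothesis indpZ : forall r i B, measurable B ->
  Pr ([set t | p t = i] `&` (fun t => U t + r * Z t)%R @^-1` B) =
  (Pr [set t | p t = i] * Pr ((fun t => U t + r * Z t)%R @^-1` B))%E.

Let mS j : measurable_fun setT (S j).
Proof. by apply: measurable_funD => //; exact: measurable_sum1. Qed.

Lemma distr_fun_partial_sum j : distr_fun Pr (S j) = iter j (avg m 1) (distr_fun Pr U).
Proof.
elim: j => [|j IHj].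
  by congr distr_fun; apply/funext => t; rewrite /S big_geq// addr0.
rewrite iterS -IHj; apply/funext => x.
rewrite -(distr_fun_addM 1 x (mS j) (mX (ltn0Sn j)) (@indSX j) (XE (ltn0Sn j))).
by congr (distr_fun _ _ x); apply/funext => t; rewrite /S big_nat_recr//= addrA mul1r.
Qed.

Lemma prob_partition (A : set T) : measurable A ->
  Pr A = (\sum_(j <oo) Pr ([set t | p t = j] `&` A))%E.
Proof.
move=> mA; have {1}-> : A = \bigcup_j ([set t | p t = j] `&` A).
  by apply/seteqP; split => [t At|t [j _ []]//]; exists (p t).
rewrite measure_bigcup//.
- by apply: eq_eseriesl => n; rewrite in_setT.
- by move=> i _; exact: measurableI.
- by move=> i j _ _ [t [[/= <- _] [/= <- _]]].
Qed.

(** Errors are weighted by the probabilities of the levels, which sum to 1, so nothing is lost by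
    conditioning. The statement is one-sided and is used in both directions. *)
Lemma mixture_le (A B : set T) (e : R) : measurable A -> measurable B -> 0 <= e ->
  (forall j, Pr ([set t | p t = j] `&` A) <=
    Pr ([set t | p t = j] `&` B) + e%:E * Pr [set t | p t = j])%E ->
  (Pr A <= Pr B + e%:E)%E.
Proof.
move=> mA mB e0 AB.
have -> : e%:E = (\sum_(j <oo) e%:E * Pr [set t | p t = j])%E.
  rewrite nneseriesZl// -[LHS]mule1 -(probability_setT Pr) (prob_partition measurableT).
  by congr (_ * _)%E; apply: eq_eseriesr => j _; rewrite setIT.
rewrite (prob_partition mA) (prob_partition mB) -nneseriesD//.
  by apply: lee_nneseries => // j _; exact: AB.
by move=> j _; rewrite mule_ge0.
Qed.

Lemma random_index_swap P x : (1 <= P)%N ->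
  `|distr_fun Pr (fun t => U t + \sum_(1 <= k < (p t).+1) X k t) x -
    distr_fun Pr (fun t => U t + (if (p t < P)%N then \sum_(1 <= k < (p t).+1) X k t
      else Num.sqrt ((p t)%:R / 3) * pi * Z t)) x| <=
  32 ^+ 2 * berry_esseen_cst / Num.sqrt P%:R.
Proof.
move=> P1; set WA := fun t => U t + _; set WY := fun t => U t + _; set e := _ / _.
have K0 := @berry_esseen_cst_ge0 R.
have e0 : 0 <= e by rewrite /e divr_ge0 ?sqrtr_ge0// mulr_ge0.
have mWA : measurable_fun setT WA.
  by apply: (measurable_random_index (F := S)).
have mG r : measurable_fun setT (fun t => U t + r * Z t).
  by apply: measurable_funD => //; exact: measurable_funM.
pose G j t := U t + (if (j < P)%N then \sum_(1 <= k < j.+1) X k t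
      else Num.sqrt (j%:R / 3) * pi * Z t).
have mWY : measurable_fun setT WY.
  apply: (measurable_random_index (F := G)) => // j; rewrite /G.
  by case: (j < P)%N; [exact: mS|exact: mG].
have AE j : [set t | p t = j] `&` [set t | WA t <= x] =
    [set t | p t = j] `&` S j @^-1` `]-oo, x].
  by rewrite set_itvNyc; apply/seteqP; split => t /= [pj]; rewrite /WA /S pj.
have YE j : [set t | p t = j] `&` [set t | WY t <= x] =
    [set t | p t = j] `&` G j @^-1` `]-oo, x].
  by rewrite set_itvNyc; apply/seteqP; split => t /= [pj]; rewrite /WY /G pj.
have sigE (j : nat) : Num.sqrt (j%:R / 3) * pi = sigma * Num.sqrt j%:R :> R.
  by rewrite /sigma sqrtrM// sqrtrV// [RHS]mulrC mulrA mulrAC.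
have step j : (P <= j)%N ->
    [/\ Pr ([set t | p t = j] `&` [set t | WA t <= x]) =
          (Pr [set t | p t = j] * (iter j (avg m 1) (distr_fun Pr U) x)%:E)%E,
        Pr ([set t | p t = j] `&` [set t | WY t <= x]) =
          (Pr [set t | p t = j] * (avg std_gauss (sigma * Num.sqrt j%:R) (distr_fun Pr U) x)%:E)%E &
        `|iter j (avg m 1) (distr_fun Pr U) x - avg std_gauss (sigma * Num.sqrt j%:R) (distr_fun Pr U) x| <= e].
  move=> Pj; have j0 : (0 < j)%N by exact: leq_trans P1 Pj.
  split.
  - by rewrite AE indpS ?measurable_itv// -distr_fun_partial_sum distr_funE// set_itvNyc.
  - rewrite YE; have -> : G j = fun t => U t + sigma * Num.sqrt j%:R * Z t.
      by apply/funext => t; rewrite /G ltnNge Pj/= sigE.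
    rewrite indpZ ?measurable_itv//.
    by rewrite -(distr_fun_addM _ x mU mZ indUZ ZE) distr_funE// set_itvNyc.
  (* The estimate is of order 1 / j with j >= P >= 1, and is relaxed through sqrt P <= sqrt j <=
     j. *)
  - have gB := distr_fun_nnbounded Pr mU.
    apply: (le_trans (logistic_sum_gauss mE x j0 gB)); rewrite mulr1 /e.
    rewrite ler_wpM2l ?mulr_ge0// lef_pV2 ?posrE ?sqrtr_gt0 ?ltr0n//.
    apply: (@le_trans _ _ (Num.sqrt j%:R)); first by rewrite ler_sqrt ?ler_nat.
    rewrite -[leRHS](@sqr_sqrtr _ j%:R)// expr2 ler_peMr ?sqrtr_ge0//.
    by rewrite -[leLHS]sqrtr1 ler_sqrt ?ler1n.
have low j : (j < P)%N -> Pr ([set t | p t = j] `&` [set t | WA t <= x]) =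
    Pr ([set t | p t = j] `&` [set t | WY t <= x]).
  by move=> jP; rewrite AE YE /G jP.
have mA := measurable_le x mWA; have mY := measurable_le x mWY.
have w0 j : (0 <= Pr [set t | p t = j])%E by [].
have h1 : (Pr [set t | (WA t <= x)%R] <= Pr [set t | (WY t <= x)%R] + e%:E)%E.
  apply: mixture_le => // j; have [jP|Pj] := ltnP j P.
    by rewrite low// leeDl// mule_ge0.
  have [-> -> h] := step _ Pj; rewrite (muleC e%:E) -muleDr ?fin_num_measure// -EFinD.
  by rewrite lee_wpmul2l// lee_fin; move: h; rewrite ler_norml => /andP[_]; lra.
have h2 : (Pr [set t | (WY t <= x)%R] <= Pr [set t | (WA t <= x)%R] + e%:E)%E.
  apply: mixture_le => // j; have [jP|Pj] := ltnP j P.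
    by rewrite low// leeDl// mule_ge0.
  have [-> -> h] := step _ Pj; rewrite (muleC e%:E) -muleDr ?fin_num_measure// -EFinD.
  by rewrite lee_wpmul2l// lee_fin; move: h; rewrite ler_norml => /andP[+ _]; lra.
rewrite -!distr_funE// -EFinD lee_fin in h1; rewrite -!distr_funE// -EFinD lee_fin in h2.
by rewrite ler_norml; apply/andP; split; lra.
Qed.

End random_index_swap.

Local Open Scope ring_scope.

(** * Hybrid sums interpolating between the two variables *)

Section hybrids.
Context {R : realType}.

Definition termA {T : Type} (Xnk : nat -> nat -> T -> R) (Pn : nat -> T -> nat) (n : nat) (t : T) : R :=
  (2 ^+ n)^-1 * \sum_(1 <= k < (Pn n t).+1) Xnk n k t.

Definition termY {T : Type} (P : nat) (Xnk : nat -> nat -> T -> R) (Pn : nat -> T -> nat)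
    (Z : nat -> T -> R) (n : nat) (t : T) : R :=
  (2 ^+ n)^-1 * (if (Pn n t < P)%N then \sum_(1 <= k < (Pn n t).+1) Xnk n k t
                 else Num.sqrt ((Pn n t)%:R / 3) * pi * Z n t).

(** Up to the factor h / (2 pi), j = 0 gives [A_N] and j = N + 1 gives [Y_N]. *)
Definition hybrid {T : Type} (N P : nat) X Xnk Pn Z (j : nat) (t : T) : R :=
  X t + \sum_(0 <= n < N.+1) (if (n < j)%N then termY P Xnk Pn Z n t else termA Xnk Pn n t).

(* Omits block b from the j-th hybrid; nothing is omitted when b > N. *)
Definition hybrid_rest {T : Type} (N P : nat) X Xnk Pn Z (b j : nat) (t : T) : R :=
  X t + \sum_(0 <= n < N.+1) (if n == b then 0 else
    if (n < j)%N then termY P Xnk Pn Z n t else termA Xnk Pn n t).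

Definition in_block (j : nat) (i : idx) : bool :=
  match i with
  | inl (inl _) => false
  | inl (inr (n, _)) => n == j
  | inr (inl n) => n == j
  | inr (inr n) => n == j
  end.

Lemma hybrid_split (T : Type) N P X Xnk Pn Z j (t : T) (F : nat -> R) : (j <= N)%N ->
  X t + \sum_(0 <= n < N.+1) (if n == j then F n else
    if (n < j)%N then termY P Xnk Pn Z n t else termA Xnk Pn n t) =
  hybrid_rest N P X Xnk Pn Z j j t + F j.
Proof.
move=> jN; rewrite /hybrid_rest !big_mkord.
rewrite (bigD1 (Ordinal (jN : j < N.+1)%N))//= [in RHS](bigD1 (Ordinal (jN : j < N.+1)%N))//= eqxx.
rewrite add0r -[RHS]addrA; congr (_ + _); rewrite [RHS]addrC; congr (_ + _).
apply: eq_bigr => i ij; case: ifPn => // /eqP iE.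
by move: ij; rewrite -val_eqE/= iE eqxx.
Qed.

Lemma hybridE (T : Type) N P X Xnk Pn Z j (t : T) : (j <= N)%N ->
  hybrid N P X Xnk Pn Z j t = hybrid_rest N P X Xnk Pn Z j j t + termA Xnk Pn j t.
Proof.
move=> jN; rewrite -(hybrid_split P X Xnk Pn Z t (fun n => termA Xnk Pn n t) jN).
congr (_ + _); apply: eq_bigr => n _; case: eqP => [->|//]; by rewrite ltnn.
Qed.

Lemma hybridSE (T : Type) N P X Xnk Pn Z j (t : T) : (j <= N)%N ->
  hybrid N P X Xnk Pn Z j.+1 t = hybrid_rest N P X Xnk Pn Z j j t + termY P Xnk Pn Z j t.
Proof.
move=> jN; rewrite -(hybrid_split P X Xnk Pn Z t (fun n => termY P Xnk Pn Z n t) jN).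
congr (_ + _); apply: eq_bigr => n _; case: eqP => [->|/eqP nj]; first by rewrite ltnSn.
by rewrite ltnS leq_eqVlt (negbTE nj).
Qed.

(** The measurable space is arbitrary so that the lemma applies both to the original sigma-algebra
    and to those of [sigma_of]. Asking for measurability outside block b only is what later yields
    independence from that block. *)
Lemma measurable_hybrid_rest d (T : measurableType d) N P X Xnk Pn Z b j :
  (forall i, valid_idx N i -> ~~ in_block b i ->
    measurable_fun setT (rv_family X Xnk Pn Z i : T -> R)) ->
  measurable_fun setT (hybrid_rest N P X Xnk Pn Z b j : T -> R).
Proof.
move=> mV; apply: measurable_funD; first exact: (mV (inl (inl tt))).
(* The guard n <= N makes every summand measurable for all n, as the lemma on measurable sums
   demands. *)
have -> : (fun t => \sum_(0 <= n < N.+1) (if n == b then 0 else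
    if (n < j)%N then termY P Xnk Pn Z n t else termA Xnk Pn n t)) =
  (fun t => \sum_(n <- iota 0 N.+1) (if (n <= N)%N then (if n == b then 0 else
    if (n < j)%N then termY P Xnk Pn Z n t else termA Xnk Pn n t) else 0)).
  apply/funext => t; rewrite /index_iota subn0; apply: eq_big_seq => n.
  by rewrite mem_iota/= add0n ltnS => ->.
apply: measurable_sum => n; case: (leqP n N) => // nN; case: eqP => // /eqP nj.
have mX k : (1 <= k)%N -> measurable_fun setT (Xnk n k) by move=> k1; exact: (mV (inl (inr (n, k))) (conj nN k1) nj).
have mP i : measurable [set t | Pn n t = i].
  by apply: (measurable_nat_level (R := R)); exact: (mV (inr (inl n)) nN nj).
have mZ : measurable_fun setT (Z n) by exact: (mV (inr (inr n)) nN nj).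
have mS i := measurable_sum1 i mX.
case: (n < j)%N; apply: measurable_funM => //.
  pose G i t := if (i < P)%N then \sum_(1 <= k < i.+1) Xnk n k t
      else Num.sqrt (i%:R / 3) * pi * Z n t.
  apply: (measurable_random_index (F := G) mP) => i; rewrite /G.
  by case: (i < P)%N => //; exact: measurable_funM.
exact: (measurable_random_index (F := fun i t => \sum_(1 <= k < i.+1) Xnk n k t) mP).
Qed.

Lemma measurable_hybrid d (T : measurableType d) N P X Xnk Pn Z j :
  (forall i, valid_idx N i -> measurable_fun setT (rv_family X Xnk Pn Z i : T -> R)) ->
  measurable_fun setT (hybrid N P X Xnk Pn Z j : T -> R).
Proof.
move=> mV; have -> : hybrid N P X Xnk Pn Z j = hybrid_rest N P X Xnk Pn Z N.+1 j.
  apply/funext => t; congr (_ + _); apply: eq_big_nat => n /andP[_ nN].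
  by rewrite (ltn_eqF nN).
by apply: measurable_hybrid_rest => i vi _; exact: mV.
Qed.

End hybrids.

Lemma hybrid_step {R : realType} (N P : nat) d (T : measurableType d) (Pr : probability T R)
    (X : T -> R) (Xnk : nat -> nat -> T -> R) (Pn : nat -> T -> nat) (Z : nat -> T -> R)
    (m : probability (measurableTypeR R) R) j x :
  has_density m logistic_pdf -> (1 <= P)%N -> (j <= N)%N ->
  (forall i, valid_idx N i -> measurable_fun setT (rv_family X Xnk Pn Z i)) ->
  (forall n k, (n <= N)%N -> (1 <= k)%N -> forall B, measurable B -> Pr (Xnk n k @^-1` B) = m B) ->
  (forall n, (n <= N)%N -> forall B, measurable B -> Pr (Z n @^-1` B) = std_gauss B) ->
  mutually_independent Pr (valid_idx N) (rv_family X Xnk Pn Z) ->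
  `|distr_fun Pr (hybrid N P X Xnk Pn Z j) x - distr_fun Pr (hybrid N P X Xnk Pn Z j.+1) x| <=
  32 ^+ 2 * berry_esseen_cst / Num.sqrt P%:R.
Proof.
move=> mE P1 jN mV XE ZE ind; set V := rv_family X Xnk Pn Z in mV ind.
have c0 : 0 < 2 ^+ j :> R by rewrite exprn_gt0.
have c1 : 2 ^+ j != 0 :> R by rewrite gt_eqF.
(* Scaling by 2^j gives the summands of block j coefficient 1 and moves the threshold to 2^j x; the
   estimate is uniform in the threshold, so the weight has no effect on it. *)
pose U t := 2 ^+ j * hybrid_rest N P X Xnk Pn Z j j t.
pose S k t := U t + \sum_(1 <= i < k.+1) Xnk j i t.
have -> : distr_fun Pr (hybrid N P X Xnk Pn Z j) x =
    distr_fun Pr (fun t => U t + \sum_(1 <= k < (Pn j t).+1) Xnk j k t) (2 ^+ j * x).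
  congr (fine (Pr _)); apply/funext => t; apply/propext => /=.
  by rewrite hybridE// /termA -(ler_pM2l c0 _ x) mulrDr mulVKf.
have -> : distr_fun Pr (hybrid N P X Xnk Pn Z j.+1) x =
    distr_fun Pr (fun t => U t + (if (Pn j t < P)%N then \sum_(1 <= k < (Pn j t).+1) Xnk j k t
      else Num.sqrt ((Pn j t)%:R / 3) * pi * Z j t)) (2 ^+ j * x).
  congr (fine (Pr _)); apply/funext => t; apply/propext => /=.
  by rewrite hybridSE// /termY -(ler_pM2l c0 _ x) mulrDr mulVKf.
(* [KU] indexes all variables outside block j, and [KS k] adds the first k logistic variables of
   that block. Each independence hypothesis then reduces to disjointness of index sets. *)
pose KU : set idx := [set i | valid_idx N i /\ ~~ in_block j i].
pose KS k : set idx := KU `|` [set i | exists2 l, (1 <= l <= k)%N & i = inl (inr (j, l))].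
have VX l : (1 <= l)%N -> valid_idx N (inl (inr (j, l))) by move=> l1; split.
have KSD k : KS k `<=` valid_idx N by move=> i [[]//|[l /andP[l1 _] ->]]; exact: VX.
have mUK K : KU `<=` K -> measurable_fun setT (U : sigma_of V K -> R).
  move=> KK; apply: measurable_funM => //.
  apply: (@measurable_hybrid_rest R _ (sigma_of V K)) => i vi bi.
  by apply: measurable_sigma_of; exact: KK.
have mSK k : measurable_fun setT (S k : sigma_of V (KS k) -> R).
  apply: measurable_funD; first by apply: mUK => i; left.
  have -> : (fun t : sigma_of V (KS k) => \sum_(1 <= i < k.+1) Xnk j i t) =
     (fun t => \sum_(i <- index_iota 1 k.+1) (if (1 <= i <= k)%N then Xnk j i t else 0)).
    by apply/funext => t; apply: eq_big_seq => i; rewrite mem_index_iota ltnS => ->.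
  apply: measurable_sum => i; case: (boolP (1 <= i <= k)%N) => // ik.
  by apply: (@measurable_sigma_of _ _ _ _ V (KS k) (inl (inr (j, i)))); right; exists i.
pose KP : set idx := [set inr (inl j)]; pose KZ : set idx := [set inr (inr j)].
have KPD : KP `<=` valid_idx N by move=> i ->.
have KZD : KZ `<=` valid_idx N by move=> i ->.
have mPK : measurable_fun setT ((fun t => (Pn j t)%:R) : sigma_of V KP -> R).
  exact: (@measurable_sigma_of _ _ _ _ V KP (inr (inl j))).
have mZK K : KZ `<=` K -> measurable_fun setT (Z j : sigma_of V K -> R).
  by move=> KK; apply: (@measurable_sigma_of _ _ _ _ V K (inr (inr j))); exact: KK.
have mX k : (1 <= k)%N -> measurable_fun setT (Xnk j k).
  by move=> k1; exact: (mV (inl (inr (j, k))) (conj jN k1)).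
have mP := mV (inr (inl j)) jN.
have mZ := mV (inr (inr j)) jN.
have levelE i : [set t | Pn j t = i] = (fun t => (Pn j t)%:R : R) @^-1` [set i%:R].
  apply/seteqP; split => t /=; first by move=> ->.
  by move=> /eqP; rewrite eqr_nat => /eqP.
apply: (@random_index_swap _ _ _ Pr U (Xnk j) (Pn j) (Z j) m mE) => //.
- apply: measurable_funM => //; apply: (@measurable_hybrid_rest R _ T) => i vi _.
  exact: mV.
- by move=> i; apply: (measurable_nat_level (R := R)).
- by move=> k k1 B mB; exact: XE.
- by move=> B mB; exact: ZE.
- move=> k A B mA mB.
  pose KX : set idx := [set inl (inr (j, k.+1))].
  have KXD : KX `<=` valid_idx N by move=> i ->; exact: VX.
  have dj : KS k `&` KX = set0.
    apply/seteqP; split => // i [KSi /= iE]; rewrite iE in KSi.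
    case: KSi => [[_]|[l /andP[_ lk] [lE]]]; first by rewrite /= eqxx.
    by move: lk; rewrite -lE ltnn.
  apply: (sigma_of_indep mV ind (KSD k) KXD dj (mSK k)) => //.
  exact: (@measurable_sigma_of _ _ _ _ V KX (inl (inr (j, k.+1)))).
- move=> A B mA mB.
  have dj : KU `&` KZ = set0.
    by apply/seteqP; split => // i [[_ bi] /= iE]; move: bi; rewrite iE /= eqxx.
  have KUD : KU `<=` valid_idx N by move=> i [].
  exact: (sigma_of_indep mV ind KUD KZD dj (mUK _ (@subset_refl _ _)) (mZK _ (@subset_refl _ _))).
- move=> k i B mB; rewrite levelE.
  have dj : KP `&` KS k = set0.
    apply/seteqP; split => // i' [/= -> [[_]|[l _]//]].
    by rewrite /= eqxx.
  exact: (sigma_of_indep mV ind KPD (KSD k) dj mPK (mSK k)).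
- move=> r i B mB; rewrite levelE.
  pose K := KU `|` KZ.
  have dj : KP `&` K = set0.
    apply/seteqP; split => // i' [/= -> [[_]|//]].
    by rewrite /= eqxx.
  have KD : K `<=` valid_idx N by move=> i' [[]//|/KZD].
  apply: (sigma_of_indep mV ind KPD KD dj mPK) => //.
  apply: measurable_funD; first by apply: mUK => ?; left.
  by apply: measurable_funM => //; apply: mZK => ?; right.
Qed.

Local Open Scope ring_scope.
Theorem theorem3 (R : realType) :
  exists c : R, 0 < c /\
  forall (h a : R) (N P : nat), 0 < h -> 0 <= a -> (1 <= P)%N ->
  forall (d : measure_display) (T : measurableType d) (Pr : probability T R)
    (X : T -> R) (Xnk : nat -> nat -> T -> R) (Pn : nat -> T -> nat)
    (Z : nat -> T -> R),
  (* measurability *)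
  measurable_fun setT X ->
  (forall n k, (n <= N)%N -> (1 <= k)%N -> measurable_fun setT (Xnk n k)) ->
  (forall n, (n <= N)%N -> measurable_fun setT (fun t => (Pn n t)%:R : R)) ->
  (forall n, (n <= N)%N -> measurable_fun setT (Z n)) ->
  (* laws: standard Logistic *)
  (forall B, measurable B ->
     Pr (X @^-1` B) = (\int[lebesgue_measure]_(x in B) (logistic_pdf x)%:E)%E) ->
  (forall n k, (n <= N)%N -> (1 <= k)%N -> forall B, measurable B ->
     Pr (Xnk n k @^-1` B) =
       (\int[lebesgue_measure]_(x in B) (logistic_pdf x)%:E)%E) ->
  (* laws: P_n ~ Poisson(a^2 2^n / 2) *)
  (forall n, (n <= N)%N -> forall j : nat,
     Pr [set t | Pn n t = j] = (poisson_mass (a ^+ 2 * 2 ^+ n / 2) j)%:E) ->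
  (* laws: Z_n ~ N(0,1) *)
  (forall n, (n <= N)%N -> forall B, measurable B ->
     Pr (Z n @^-1` B) = normal_prob 0 1 B) ->
  (* mutual independence of all these random variables *)
  mutually_independent Pr (valid_idx N) (rv_family X Xnk Pn Z) ->
  forall x : R,
    (`| Pr [set t | (A_N h N X Xnk Pn t <= x)%R] -
        Pr [set t | (Y_N h N P X Xnk Pn Z t <= x)%R] |
      <= (c * (N.+1)%:R / Num.sqrt (P%:R))%:E)%E.
Proof.
(* The added 1 gives strict positivity from [berry_esseen_cst_ge0]. *)
exists (32 ^+ 2 * berry_esseen_cst + 1).
have K0 := @berry_esseen_cst_ge0 R.
split; first by rewrite ltr_wpDl// mulr_ge0.
move=> h a N P h0 a0 P1 d T Pr X Xnk Pn Z mX mXnk mPn mZ LX LXnk LPn LZ ind x.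
pose X' : T -> measurableTypeR R := X.
have mX' : measurable_fun setT X' by [].
pose m : probability (measurableTypeR R) R := distribution Pr (mfun_Sub (mem_set mX')).
have mE : has_density m logistic_pdf by move=> B mB; exact: LX.
have mV i : valid_idx N i -> measurable_fun setT (rv_family X Xnk Pn Z i).
  case: i => [[[]//|[n k] [nN k1]]|[n nN|n nN]] /=.
  - exact: mXnk.
  - exact: mPn.
  - exact: mZ.
pose F := hybrid N P X Xnk Pn Z.
have mF j : measurable_fun setT (F j) := measurable_hybrid P j mV.
(* The positive scale h / (2 pi) is absorbed into the threshold, which makes the bound independent
   of h. *)
pose y := x / (h / (2 * pi)).
have c0 : 0 < h / (2 * pi) by rewrite divr_gt0// mulr_gt0// pi_gt0.
have EA : Pr [set t | A_N h N X Xnk Pn t <= x] = (distr_fun Pr (F 0%N) y)%:E.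
  rewrite distr_funE//; congr (Pr _); apply/funext => t; apply/propext => /=.
  rewrite /A_N mulrC -ler_pdivlMr//.
have EY : Pr [set t | Y_N h N P X Xnk Pn Z t <= x] = (distr_fun Pr (F N.+1) y)%:E.
  rewrite distr_funE//; congr (Pr _); apply/funext => t; apply/propext => /=.
  rewrite /Y_N mulrC -ler_pdivlMr// /F /hybrid.
  rewrite [X in _ <-> _ + X <= _](_ : _ = \sum_(0 <= n < N.+1) termY P Xnk Pn Z n t)//.
  by apply: eq_big_nat => n /andP[_ ->].
rewrite EA EY -EFinB abse_EFin lee_fin.
have XE n k : (n <= N)%N -> (1 <= k)%N -> forall B, measurable B -> Pr (Xnk n k @^-1` B) = m B.
  by move=> nN k1 B mB; rewrite (LXnk n k nN k1 B mB); exact/esym/mE.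
have step j : (j < N.+1)%N -> `|distr_fun Pr (F j) y - distr_fun Pr (F j.+1) y| <=
    32 ^+ 2 * berry_esseen_cst / Num.sqrt P%:R.
  by rewrite ltnS => jN; exact: (hybrid_step y mE P1 jN mV XE LZ ind).
have -> : distr_fun Pr (F 0%N) y - distr_fun Pr (F N.+1) y =
    \sum_(0 <= j < N.+1) (distr_fun Pr (F j) y - distr_fun Pr (F j.+1) y).
  rewrite -[LHS]opprB -(telescope_sumr (fun j => distr_fun Pr (F j) y)) ?leq0n//.
  by rewrite -sumrN; apply: eq_bigr => j _; rewrite opprB.
rewrite big_mkord (le_trans (ler_norm_sum _ _ _))//.
rewrite (le_trans (ler_sum _ (fun j _ => step _ (ltn_ord j))))//.
rewrite sumr_const card_ord -[leLHS]mulr_natl mulrA ler_wpM2r ?invr_ge0 ?sqrtr_ge0//.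
by rewrite mulrC ler_wpM2r// lerDl.
Qed.
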